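(* Let $F$ be a free group of finite rank $n>1$ with basis $a_1,\dots,a_n$, and let $w\in F$. If $w$ is equivalent to a polygonal word (i.e. some automorphism of $F$ maps $w$ to a polygonal word), then the double $D(w)=F*_{\langle w\rangle}F$ (two copies of $F$ amalgamated along the two copies of $\langle w\rangle$ identified via the identity) contains a surface group, i.e. a subgroup isomorphic to the fundamental group of a closed surface of non-positive Euler characteristic.
   Context: Polygonality. Let $R$ be the bouquet of $n$ oriented circles labeled $a_1,\dots,a_n$, so that $\pi_1(R)=F$. A graph is a 1-dimensional CW-complex; a graph map sends vertices to vertices and edges to edges; an immersion is a locally injective graph map. An immersion from a graph to $R$ induces an orientation and a label on each edge of the graph. A polygonal disk $P$ is a 2-disk whose boundary $\partial P$ has the CW-structure of a polygon. A side-pairing $\sim$ on polygonal disks $P_1,\dots,P_m$ is an equivalence relation on the set of all edges of $\coprod_i\partial P_i$ with every class of size exactly two, together with a choice of homeomorphism between the edges in each class. Then $S=\coprod_i P_i/\!\sim$ is a closed surface with a CW-structure having $m(S)=m$ two-cells. For a cyclically reduced word $w\in F$, $S$ is a closed $w$-polygonal surface if there is an immersion $\phi\colon S^{(1)}\to R$ such that for every $i$ the composition $\partial P_i\to S^{(1)}\to R$ is an immersion reading (from a suitable starting vertex and in a suitable direction) a non-zero power of $w$. The word $w$ is polygonal if it is cyclically reduced and there exists a closed $w$-polygonal surface $S$ with $\chi(S)<m(S)$. *)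

(* Defs.v *)
From HB Require Import structures.
From mathcomp Require Import all_boot all_order all_algebra.
From mathcomp Require Import boolp.

Set Implicit Arguments.
Unset Strict Implicit.
Unset Printing Implicit Defensive.

Import Order.TTheory GRing.Theory Num.Theory.

Local Open Scope quotient_scope.
Local Open Scope group_scope.

(* A set with operations satisfying the group axioms only up to an           *)
(* equivalence relation pg_eq, compatible with multiplication.               *)
Record pregroup := Pregroup {
  pg_sort :> choiceType;
  pg_mul : pg_sort -> pg_sort -> pg_sort;
  pg_one : pg_sort;
  pg_inv : pg_sort -> pg_sort;
  pg_eq : pg_sort -> pg_sort -> Prop;
  pg_refl : forall x, pg_eq x x;
  pg_sym : forall x y, pg_eq x y -> pg_eq y x;
  pg_trans : forall x y z, pg_eq x y -> pg_eq y z -> pg_eq x z;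
  pg_mulE : forall x x' y y',
    pg_eq x x' -> pg_eq y y' -> pg_eq (pg_mul x y) (pg_mul x' y');
  pg_mulA : forall x y z,
    pg_eq (pg_mul x (pg_mul y z)) (pg_mul (pg_mul x y) z);
  pg_mul1g : forall x, pg_eq (pg_mul pg_one x) x;
  pg_mulg1 : forall x, pg_eq (pg_mul x pg_one) x;
  pg_mulVg : forall x, pg_eq (pg_mul (pg_inv x) x) pg_one;
  pg_mulgV : forall x, pg_eq (pg_mul x (pg_inv x)) pg_one
}.

Section QuotientGroup.
Variable P : pregroup.

Definition pg_rel : rel P := fun x y => `[< @pg_eq P x y >].

Lemma pg_rel_refl : reflexive pg_rel.
Proof. by move=> x; apply/asboolP; apply: pg_refl. Qed.

Lemma pg_rel_sym : symmetric pg_rel.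
Proof. by move=> x y; apply/asboolP/asboolP; apply: pg_sym. Qed.

Lemma pg_rel_trans : transitive pg_rel.
Proof.
by move=> y x z /asboolP xy /asboolP yz; apply/asboolP; apply: pg_trans xy yz.
Qed.

Canonical pg_equiv := EquivRel pg_rel pg_rel_refl pg_rel_sym pg_rel_trans.

Definition quotg : Type := {eq_quot pg_equiv}.
HB.instance Definition _ := Choice.on quotg.

Definition pg_class (x : P) : quotg := \pi_{eq_quot pg_equiv} x.

Lemma pg_classP (x y : P) : pg_class x = pg_class y <-> pg_eq x y.
Proof.
split; first by move=> /eqmodP /asboolP.
by move=> xy; apply/eqmodP; apply/asboolP.
Qed.

Lemma pg_class_surj (q : quotg) : exists x, pg_class x = q.
Proof. by exists (repr (q : {eq_quot pg_equiv})); apply: reprK. Qed.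

Lemma pg_class_repr (x : P) : pg_eq (repr (pg_class x : {eq_quot pg_equiv})) x.
Proof. by apply/pg_classP; apply: reprK. Qed.

Let rep (q : quotg) : P := repr (q : {eq_quot pg_equiv}).

Definition quotg_mul (q r : quotg) := pg_class (pg_mul (rep q) (rep r)).
Definition quotg_inv (q : quotg) := pg_class (pg_inv (rep q)).
Definition quotg_one := pg_class (pg_one P).

Lemma quotg_mulE x y : quotg_mul (pg_class x) (pg_class y) = pg_class (pg_mul x y).
Proof. by apply/pg_classP/pg_mulE; apply: pg_class_repr. Qed.

Lemma pg_invE x y : pg_eq x y -> pg_eq (@pg_inv P x) (pg_inv y).
Proof.
move=> xy; apply: pg_trans (pg_sym (pg_mulg1 _)) _.
apply: pg_trans (pg_mulE (pg_refl _) (pg_sym (pg_mulgV y))) _.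
apply: pg_trans (pg_mulA _ _ _) _.
apply: pg_trans _ (pg_mul1g _); apply: pg_mulE; last exact: pg_refl.
apply: pg_trans (pg_mulE (pg_refl _) (pg_sym xy)) _; exact: pg_mulVg.
Qed.

Lemma quotg_invE x : quotg_inv (pg_class x) = pg_class (pg_inv x).
Proof. by apply/pg_classP/pg_invE/pg_class_repr. Qed.

Lemma quotg_mulA : associative quotg_mul.
Proof.
move=> q r s; have [x <-] := pg_class_surj q; have [y <-] := pg_class_surj r.
by have [z <-] := pg_class_surj s; rewrite !quotg_mulE; apply/pg_classP/pg_mulA.
Qed.

Lemma quotg_mul1g : left_id quotg_one quotg_mul.
Proof.
by move=> q; have [x <-] := pg_class_surj q; rewrite quotg_mulE; apply/pg_classP/pg_mul1g.
Qed.

Lemma quotg_mulg1 : right_id quotg_one quotg_mul.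
Proof.
by move=> q; have [x <-] := pg_class_surj q; rewrite quotg_mulE; apply/pg_classP/pg_mulg1.
Qed.

Lemma quotg_mulVg : left_inverse quotg_one quotg_inv quotg_mul.
Proof.
move=> q; have [x <-] := pg_class_surj q.
by rewrite quotg_invE quotg_mulE; apply/pg_classP/pg_mulVg.
Qed.

Lemma quotg_mulgV : right_inverse quotg_one quotg_inv quotg_mul.
Proof.
move=> q; have [x <-] := pg_class_surj q.
by rewrite quotg_invE quotg_mulE; apply/pg_classP/pg_mulgV.
Qed.

HB.instance Definition _ := isGroup.Build quotg
  quotg_mulA quotg_mul1g quotg_mulg1 quotg_mulVg quotg_mulgV.

Lemma pg_class_mul x y : pg_class x * pg_class y = pg_class (pg_mul x y).
Proof. exact: quotg_mulE. Qed.

Lemma pg_class_inv x : (pg_class x)^-1 = pg_class (pg_inv x).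
Proof. exact: quotg_invE. Qed.

Lemma pg_class_one : 1 = pg_class (pg_one P).
Proof. by []. Qed.

End QuotientGroup.

(* (x, true) stands for the generator x and (x, false) for its inverse. *)
Definition letter (X : Type) : Type := (X * bool)%type.
Definition word (X : Type) : Type := seq (letter X).

Definition inv_letter X (l : letter X) : letter X := (l.1, ~~ l.2).
Definition inv_word X (u : word X) : word X := rev (map (@inv_letter X) u).

Definition pow_word X (u : word X) (k : int) : word X :=
  match k with
  | Posz j => flatten (nseq j u)
  | Negz j => flatten (nseq j.+1 (inv_word u))
  end.

(* [cycle] also compares the last letter with the first one. *)
Definition cyclically_reduced (X : eqType) (u : word X) : bool :=
  cycle (fun l l' : X * bool => l' != inv_letter l) u.

Lemma inv_letterK X : involutive (@inv_letter X).
Proof. by case=> x b; rewrite /inv_letter /= negbK. Qed.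

Lemma inv_wordK X : involutive (@inv_word X).
Proof.
move=> u; rewrite /inv_word map_rev revK -map_comp -[RHS]map_id.
by apply: eq_map => l /=; rewrite inv_letterK.
Qed.

Inductive pres_eq X (R : word X -> word X -> Prop) : word X -> word X -> Prop :=
| PresRefl u : pres_eq R u u
| PresSym u v : pres_eq R u v -> pres_eq R v u
| PresTrans u v t : pres_eq R u v -> pres_eq R v t -> pres_eq R u t
| PresCat u u' v v' :
    pres_eq R u u' -> pres_eq R v v' -> pres_eq R (u ++ v) (u' ++ v')
| PresCancel l : pres_eq R [:: l; inv_letter l] [::]
| PresRel u v : R u v -> pres_eq R u v.

Lemma pres_mulgV X (R : word X -> word X -> Prop) u :
  pres_eq R (u ++ inv_word u) [::].
Proof.
elim: u => [|l u IHu]; first exact: PresRefl.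
have -> : (l :: u) ++ inv_word (l :: u) =
    [:: l] ++ ((u ++ inv_word u) ++ [:: inv_letter l]).
  by rewrite /inv_word /= rev_cons -cats1 !catA.
apply: PresTrans (PresCat (PresRefl _ _) (PresCat IHu (PresRefl _ _))) _.
exact: PresCancel.
Qed.

Lemma pres_mulVg X (R : word X -> word X -> Prop) u :
  pres_eq R (inv_word u ++ u) [::].
Proof. by rewrite -{2}[u]inv_wordK; apply: pres_mulgV. Qed.

Section PresentedGroup.
Variables (X : choiceType) (R : word X -> word X -> Prop).

Definition pres_pregroup : pregroup.
Proof.
refine (@Pregroup (word X) cat [::] (@inv_word X) (pres_eq R)
  (@PresRefl X R) (@PresSym X R) (@PresTrans X R) (@PresCat X R)
  _ _ _ (@pres_mulVg X R) (@pres_mulgV X R)).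
- by move=> x y z; rewrite catA; apply: PresRefl.
- by move=> x; apply: PresRefl.
- by move=> x; rewrite cats0; apply: PresRefl.
Defined.

Definition presented : groupType := quotg pres_pregroup.
Definition presented_class (u : word X) : presented := @pg_class pres_pregroup u.

End PresentedGroup.

Definition free_group (n : nat) : groupType :=
  @presented 'I_n (fun _ _ => False).

Definition free_class n (u : word 'I_n) : free_group n :=
  presented_class (fun _ _ => False) u.

Definition cyclic_subgroup (G : groupType) (w : G) (h : G) : Prop :=
  exists k : nat, h = w ^+ k \/ h = w ^- k.

(* The amalgamated product G *_H G is generated by two disjoint copies of the *)
(* underlying set of G, subject to the multiplication table of each copy and *)
(* to the identification of the two copies of H.                             *)
Inductive double_rel (G : groupType) (H : G -> Prop) :
  word (G + G)%type -> word (G + G)%type -> Prop :=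
| DoubleL x y :
    double_rel H [:: (inl x, true); (inl y, true)] [:: (inl (x * y), true)]
| DoubleR x y :
    double_rel H [:: (inr x, true); (inr y, true)] [:: (inr (x * y), true)]
| DoubleH h : H h -> double_rel H [:: (inl h, true)] [:: (inr h, true)].

Definition double_over (G : groupType) (H : G -> Prop) : groupType :=
  @presented (G + G)%type (@double_rel G H).

Definition double_group n (w : free_group n) : groupType :=
  double_over (cyclic_subgroup w).

(* Monogons and bigons are allowed as polygonal disks.                       *)
(* The sides of the i-th polygonal disk are numbered cyclically along its    *)
(* boundary; the chosen homeomorphism between a side s and its partner       *)
(* mate s only matters up to isotopy, i.e. through the boolean flip s        *)
(* telling whether it reverses the boundary directions.                      *)
Record surface := Surface {
  npoly : nat;
  nside : 'I_npoly -> nat;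
  nside_gt0 : forall i, (0 < nside i)%N;
  mate : {i : 'I_npoly & 'I_(nside i)} -> {i : 'I_npoly & 'I_(nside i)};
  mateK : involutive mate;
  mate_neq : forall s, mate s != s;
  flip : {i : 'I_npoly & 'I_(nside i)} -> bool;
  flip_mate : forall s, flip (mate s) = flip s
}.

Section SurfaceTheory.
Variable S : surface.

Definition side : finType := {i : 'I_(npoly S) & 'I_(nside i)}.

(* A corner is named after the side that starts at it. *)
Definition corner : finType := side.

Definition mk_side (i : 'I_(npoly S)) (j : 'I_(nside i)) : side :=
  Tagged (fun i => 'I_(nside i)) j.

Definition next_side (s : side) : side := mk_side (ordS (tagged s)).

(* A directed side: (s, true) is s run through in the boundary direction. *)
Definition dart : finType := (side * bool)%type.

Definition dart_rev (d : dart) : dart := (d.1, ~~ d.2).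
Definition dart_src (d : dart) : corner := if d.2 then d.1 else next_side d.1.
Definition dart_tgt (d : dart) : corner := dart_src (dart_rev d).
Definition dart_mate (d : dart) : dart := (mate d.1, d.2 (+) flip d.1).

Definition corner_glue : rel corner :=
  fun x y => [exists d : dart, (x == dart_src d) && (y == dart_src (dart_mate d))].

Definition same_vertex : rel corner := connect corner_glue.

Lemma dart_revK : involutive dart_rev.
Proof. by case=> s b; rewrite /dart_rev /= negbK. Qed.

Lemma dart_mateK : involutive dart_mate.
Proof. by case=> s b; rewrite /dart_mate /= mateK flip_mate addbK. Qed.

Lemma corner_glue_sym : symmetric corner_glue.
Proof.
by move=> x y; apply/existsP/existsP => -[d /andP[xd yd]];
  exists (dart_mate d); rewrite dart_mateK yd xd.
Qed.

Lemma same_vertex_sym : symmetric same_vertex.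
Proof. exact: sym_connect_sym corner_glue_sym. Qed.

Definition nvertices : nat := n_comp corner_glue [pred x : corner | true].
Definition nedges : nat := fcard (@mate S : side -> side) [pred s : side | true].

Definition euler_char : int := (nvertices%:Z - nedges%:Z + (npoly S)%:Z)%R.

(* d and dart_mate d are the same directed edge of the 1-skeleton, so paths  *)
(* only have to match up to same_vertex; MoveGlue below identifies the two   *)
(* names of an edge.                                                         *)
Fixpoint is_path (x : corner) (p : seq dart) (y : corner) : bool :=
  if p is d :: q then same_vertex x (dart_src d) && is_path (dart_tgt d) q y
  else same_vertex x y.

Definition surface_connected : Prop :=
  forall x y : corner, exists p, is_path x p y.

Definition path_rev (p : seq dart) : seq dart := rev (map dart_rev p).

Definition poly_boundary (i : 'I_(npoly S)) : seq dart :=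
  [seq (mk_side j, true) | j <- enum 'I_(nside i)].

(* The fundamental group is the edge-path group of the CW-structure. The     *)
(* boundary of each disk is only filled in from its corner 0: the other      *)
(* starting corners follow by inserting and removing spurs.                  *)
Inductive elementary_move : seq dart -> seq dart -> Prop :=
| MoveSpur d : elementary_move [:: d; dart_rev d] [::]
| MoveGlue d : elementary_move [:: d] [:: dart_mate d]
| MoveDisk i : elementary_move (poly_boundary i) [::].

Lemma same_vertex_trans : transitive same_vertex.
Proof. exact: connect_trans. Qed.

Lemma is_path_eql x x' p y : same_vertex x x' -> is_path x p y = is_path x' p y.
Proof.
move=> xx'; have E z : same_vertex x z = same_vertex x' z.
  apply/idP/idP; last exact: connect_trans xx'.
  by apply: connect_trans; rewrite -/(same_vertex _ _) same_vertex_sym.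
by case: p => [|d p] /=; rewrite E.
Qed.

Lemma is_path_cat x y z p q :
  is_path x p y -> is_path y q z -> is_path x (p ++ q) z.
Proof.
elim: p x => [|d p IHp] x /=; first by move=> xy; rewrite (is_path_eql _ _ xy).
by case/andP=> -> /= pP qP; apply: IHp.
Qed.

Lemma is_path_rev x y p : is_path x p y -> is_path y (path_rev p) x.
Proof.
elim: p x => [|d p IHp] x /=; first by rewrite same_vertex_sym.
case/andP=> xd /IHp pP; rewrite /path_rev /= rev_cons -cats1.
apply: is_path_cat pP _ => /=; rewrite /dart_tgt dart_revK.
by rewrite same_vertex_sym in xd; rewrite xd andbT; apply: connect0.
Qed.

Variable v : corner.

Definition loop : Type := {p : seq dart | is_path v p v}.
HB.instance Definition _ := Choice.on loop.

Inductive homotopic : loop -> loop -> Prop :=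
| HomRefl p : homotopic p p
| HomSym p q : homotopic p q -> homotopic q p
| HomTrans p q r : homotopic p q -> homotopic q r -> homotopic p r
| HomMove x a b y (p q : loop) :
    val p = x ++ a ++ y -> val q = x ++ b ++ y -> elementary_move a b ->
    homotopic p q.

Definition loop_cat (p q : loop) : loop :=
  exist _ (val p ++ val q) (is_path_cat (valP p) (valP q)).
Definition loop_one : loop := exist _ [::] (connect0 _ _).
Definition loop_inv (p : loop) : loop :=
  exist _ (path_rev (val p)) (is_path_rev (valP p)).

Lemma homotopic_catl p p' q :
  homotopic p p' -> homotopic (loop_cat p q) (loop_cat p' q).
Proof.
elim=> {p p'} [p|p p' _|p1 p2 p3 _ IH1 _ IH2|x a b y p p' Ep Ep' ab].
- exact: HomRefl.
- exact: HomSym.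
- exact: HomTrans IH1 IH2.
- by apply: (@HomMove x a b (y ++ val q)) => //=; rewrite ?Ep ?Ep' -!catA.
Qed.

Lemma homotopic_catr p q q' :
  homotopic q q' -> homotopic (loop_cat p q) (loop_cat p q').
Proof.
elim=> {q q'} [q|q q' _|q1 q2 q3 _ IH1 _ IH2|x a b y q q' Eq Eq' ab].
- exact: HomRefl.
- exact: HomSym.
- exact: HomTrans IH1 IH2.
- by apply: (@HomMove (val p ++ x) a b y) => //=; rewrite ?Eq ?Eq' -!catA.
Qed.

Lemma homotopic_val (p q : loop) : val p = val q -> homotopic p q.
Proof. by move=> /val_inj ->; apply: HomRefl. Qed.

Lemma is_path_spur x y d u t :
  is_path x (u ++ [:: d; dart_rev d] ++ t) y -> is_path x (u ++ t) y.
Proof.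
elim: u x => [|e u IHu] x /=; last by case/andP=> -> /IHu.
by rewrite /dart_tgt dart_revK => /and3P[xd _]; rewrite (is_path_eql _ _ xd).
Qed.

Lemma homotopic_rev p (r : loop) : val r = p ++ path_rev p -> homotopic r loop_one.
Proof.
elim/last_ind: p r => [|p d IHp] r Er; first by apply: homotopic_val; rewrite Er.
have Erd : val r = p ++ [:: d; dart_rev d] ++ path_rev p.
  by rewrite Er /path_rev map_rcons rev_rcons -cats1 -catA.
have tP : is_path v (p ++ path_rev p) v.
  by apply: (@is_path_spur _ _ d); rewrite -Erd; apply: valP r.
pose t : loop := exist (fun p => is_path v p v) _ tP; apply: (@HomTrans _ t); last exact: IHp.
exact: (@HomMove p _ [::] (path_rev p) r t Erd erefl (MoveSpur d)).
Qed.

Lemma homotopic_mulgV p : homotopic (loop_cat p (loop_inv p)) loop_one.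
Proof. exact: (@homotopic_rev (val p)). Qed.

Lemma path_revK : involutive path_rev.
Proof.
move=> p; rewrite /path_rev map_rev revK -map_comp -[RHS]map_id.
by apply: eq_map => d /=; rewrite dart_revK.
Qed.

Lemma homotopic_mulVg p : homotopic (loop_cat (loop_inv p) p) loop_one.
Proof.
apply: HomTrans (homotopic_mulgV (loop_inv p)).
by apply: homotopic_val; rewrite /= path_revK.
Qed.

Definition loop_pregroup : pregroup.
Proof.
refine (@Pregroup loop loop_cat loop_one loop_inv homotopic
  HomRefl HomSym HomTrans _ _ _ _ homotopic_mulVg homotopic_mulgV).
- move=> p p' q q' pp' qq'.
  exact: HomTrans (homotopic_catl _ pp') (homotopic_catr _ qq').
- by move=> p q r; apply: homotopic_val; rewrite /= catA.
- by move=> p; apply: homotopic_val.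
- by move=> p; apply: homotopic_val; rewrite /= cats0.
Defined.

Definition fundamental_group : groupType := quotg loop_pregroup.

End SurfaceTheory.

(* Every closed surface is a quotient of polygonal disks by a side-pairing,  *)
(* so quantifying over S covers all closed surfaces.                         *)
Definition contains_surface_group (G : groupType) : Prop :=
  exists (S : surface) (v : corner S),
    [/\ surface_connected S,
        (euler_char S <= 0)%R &
        exists f : {multiplicative fundamental_group v -> G}, injective f].

Section Polygonality.
Variables (S : surface) (n : nat).

(* A graph map from the 1-skeleton of S to the bouquet of n oriented circles, *)
(* given by the signed label it induces on each side, read in the boundary   *)
(* direction.                                                                *)
Variable phi : side S -> letter 'I_n.

Definition dart_label (d : dart S) : letter 'I_n :=
  if d.2 then phi d.1 else inv_letter (phi d.1).

Definition is_graph_map : Prop :=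
  forall d : dart S, dart_label (dart_mate d) = dart_label d.

(* Local injectivity: two directed edges issuing from the same vertex with   *)
(* the same signed label are equal.                                          *)
Definition is_immersion : Prop :=
  forall d d' : dart S,
    same_vertex (dart_src d) (dart_src d') -> dart_label d = dart_label d' ->
    d' = d \/ d' = dart_mate d.

Definition boundary_word (i : 'I_(npoly S)) : word 'I_n :=
  [seq dart_label d | d <- poly_boundary i].

(* r is the starting vertex and dir the direction of reading. *)
Definition reads_power (u w : word 'I_n) : Prop :=
  exists (r : nat) (dir : bool) (k : int),
    k != 0%R /\ rot r (if dir then u else inv_word u) = pow_word w k.

Definition w_polygonal_surface (w : word 'I_n) : Prop :=
  [/\ is_graph_map, is_immersion &
      forall i, cyclically_reduced (boundary_word i) /\
                reads_power (boundary_word i) w].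

End Polygonality.

Definition polygonal n (w : word 'I_n) : Prop :=
  cyclically_reduced w /\
  exists (S : surface) (phi : side S -> letter 'I_n),
    w_polygonal_surface phi w /\ (euler_char S < (npoly S)%:Z)%R.

Definition equivalent_to_polygonal n (w : free_group n) : Prop :=
  exists (f : {multiplicative free_group n -> free_group n}) (u : word 'I_n),
    [/\ bijective f, polygonal u & f w = free_class u].

(* Main.v *)
From HB Require Import structures.
Require Import Defs.
From mathcomp Require Import all_boot all_order all_algebra.
From mathcomp Require Import boolp zify.

(* Removing an open disk from each face of (a component of) the polygonal      *)
(* surface S leaves a surface S' with chi(S') < 0 which retracts onto the      *)
(* 1-skeleton of S, and whose boundary circles read powers of the polygonal    *)
(* word u.  Gluing two copies of S' along their boundaries gives a closed      *)
(* surface T with chi(T) = 2 chi(S'), and reading labels in the two factors    *)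
(* maps pi_1(T) to the double D(u).  A loop of T alternates between the two    *)
(* copies of the 1-skeleton, and by the normal form theorem for amalgams it    *)
(* can only die in D(u) if one of its stretches h, between corners c1 and c2   *)
(* of faces, reads a segment of the axis of u.  The 1-skeleton being immersed  *)
(* in the bouquet, h is then homotopic to a path along the face of c1 ending   *)
(* at the vertex of c2 and at the same position of u.  Two distinct corners at *)
(* the same vertex and position would force their faces to be glued along      *)
(* their whole boundaries, so that S' would be an annulus or a Moebius band;   *)
(* hence the path ends at c2, h can be pushed across the annulus of the face,  *)
(* and the loop gets simpler.                                                  *)

Set Implicit Arguments.
Unset Strict Implicit.
Unset Printing Implicit Defensive.

Local Open Scope quotient_scope.
Local Open Scope group_scope.

(** * Free groups and amalgams *)

(** Let [u] be the polygonal word equivalent to [w]. Some side of the polygonal surface is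
    nondegenerate ([exists_nondegenerate]): otherwise every vertex would have exactly two corners,
    giving as many vertices as edges, and the Euler characteristic would equal the number of faces.
    Work in the component of that side, with faces reoriented to read [u] forwards. Its double T
    ([double_surface]) is tiled by squares, and each of its vertices has at least four corners, so
    chi(T) <= 0 ([euler_double_surface]).

    Let P(c) be the prefix of [u] read before the corner c. An edge in copy b goes to its letter in
    factor b of the double, and the vertical edge at c goes to P(c)_0^-1 P(c)_1. Squares die because
    P(c) times the letter read at c is P of the next corner up to a power of [u], and such powers
    are amalgamated ([transfer_nx]).

    Injectivity ([path_val_trivial]) is by induction on the number of vertical edges of a loop.
    Suppose a level stretch h between consecutive vertical edges at c1 and c2 has P(c1) h P(c2)^-1
    in the subgroup of [u]. Then [flat_trivial] and [corner_inj] make h homotopic to a path along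
    one face ([homotopic_forward]), and both vertical edges can be removed ([homotopic_remove]). If
    there is no such stretch, the value is an alternating product of elements outside the
    amalgamated subgroup, nontrivial by the action on normal forms ([irreducible_normal_form]). *)

Section MulMorphism.
Variables (G H : groupType) (f : G -> H).
Hypothesis fM : {morph f : x y / x * y}.

Lemma morph_mul1 : f 1 = 1.
Proof. by apply: (@mulgI _ (f 1)); rewrite -fM !mulg1. Qed.

Lemma morph_mulV x : f x^-1 = (f x)^-1.
Proof. by apply: (@mulgI _ (f x)); rewrite -fM !mulgV morph_mul1. Qed.

Lemma morph_mulX x k : f (x ^+ k) = f x ^+ k.
Proof. by elim: k => [|k IH]; rewrite ?morph_mul1 // !expgS fM IH. Qed.

Lemma morph_mul_inj : (forall x, f x = 1 -> x = 1) -> injective f.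
Proof.
by move=> f1 x y xy; apply/divg1_eq/f1; rewrite fM morph_mulV xy mulgV.
Qed.

End MulMorphism.

Section Presentations.
Variables (X : choiceType) (R : word X -> word X -> Prop).

Lemma presented_class_cat u v :
  presented_class R (u ++ v) = presented_class R u * presented_class R v.
Proof. by rewrite /presented_class pg_class_mul. Qed.

Lemma presented_class_nil : presented_class R [::] = 1.
Proof. exact: pg_class_one. Qed.

Lemma presented_class_inv u :
  presented_class R (inv_word u) = (presented_class R u)^-1.
Proof. by rewrite /presented_class pg_class_inv. Qed.

Lemma presented_classP u v :
  presented_class R u = presented_class R v <-> pres_eq R u v.
Proof. exact: (@pg_classP (pres_pregroup R)). Qed.

Lemma presented_class_surj (g : presented R) : exists u, presented_class R u = g.
Proof. exact: (@pg_class_surj (pres_pregroup R)). Qed.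

End Presentations.

Section FreeReduction.
Variable X : choiceType.
Implicit Types (l : X * bool) (u v s : seq (X * bool)).

(** Van der Waerden's trick: the free group acts on reduced words, a letter acting by multiplication
    followed by cancellation. *)
Definition push l s :=
  if s is l' :: s' then if l' == inv_letter l then s' else l :: s else [:: l].

Definition reduced s := sorted (fun l l' => l' != inv_letter l) s.

Lemma push_reduced l s : reduced s -> reduced (push l s).
Proof.
case: s => [|l' s] //= Hs; case: eqP => [_|/eqP ne] /=; last by rewrite ne Hs.
exact: path_sorted Hs.
Qed.

Lemma pushK l s : reduced s -> push l (push (inv_letter l) s) = s.
Proof.
case: s => [|l' s] /=; first by rewrite eqxx.
rewrite inv_letterK; case: eqP => [->|ne _] /=; last by rewrite eqxx.
by case: s => [|l2 s] //= /andP[/negPf ->].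
Qed.

Lemma foldr_push_reduced u s : reduced s -> reduced (foldr push s u).
Proof. by move=> Hs; elim: u => //= l u /(push_reduced l). Qed.

Lemma pres_eq_foldr_push u v : pres_eq (fun _ _ => False) u v ->
  forall s, reduced s -> foldr push s u = foldr push s v.
Proof.
elim=> {u v} [u|u v _ IH|u v t _ IH1 _ IH2|u u' v v' _ IHu _ IHv|l|//] s Hs //.
- by rewrite IH.
- by rewrite IH1 ?IH2.
- by rewrite !foldr_cat IHv // IHu // foldr_push_reduced.
- by rewrite /= pushK.
Qed.

Lemma foldr_push_id u : reduced u -> foldr push [::] u = u.
Proof.
elim: u => //= l u IH Hu; rewrite IH; last exact: path_sorted Hu.
by case: u Hu {IH} => //= l' u /andP[/negPf ->].
Qed.

(** Acting on the empty word, a reduced word returns itself and a trivial word returns the empty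
    word; so a nonempty trivial word is not reduced. *)
Lemma trivial_word_cancels u : presented_class (fun _ _ => False) u = 1 ->
  u != [::] -> exists u1 l u2, u = u1 ++ [:: l, inv_letter l & u2].
Proof.
rewrite -presented_class_nil => /presented_classP /pres_eq_foldr_push /(_ [::] isT) E.
have [/foldr_push_id E' | nred _] := boolP (reduced u); first by rewrite -E' E.
elim: u {E} nred => //= l [|l' u] IH //=.
rewrite negb_and negbK => /orP[/eqP->|/IH[u1 [l2 [u2 ->]]]]; first by exists [::], l, u.
by exists (l :: u1), l2, u2.
Qed.

End FreeReduction.

(** * Normal forms in the double of a group along a subgroup *)

Section Amalgam.
Variables (G : groupType) (H : G -> Prop).
Hypotheses (H1 : H 1) (HM : forall x y, H x -> H y -> H (x * y)) (HV : forall x, H x -> H x^-1).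

Let D := double_over H.

Definition amalg_in (b : bool) (g : G) : D :=
  presented_class (double_rel H) [:: (if b then inr g else inl g, true)].

Lemma amalg_inM b : {morph amalg_in b : x y / x * y}.
Proof.
move=> x y; rewrite /amalg_in -presented_class_cat.
apply/presented_classP/PresSym/PresRel.
by case: b; [apply: DoubleR|apply: DoubleL].
Qed.

Lemma amalg_in_sub b b' h : H h -> amalg_in b h = amalg_in b' h.
Proof.
move=> Hh; have E : amalg_in false h = amalg_in true h.
  exact/presented_classP/PresRel/DoubleH.
by case: b; case: b'.
Qed.

Lemma subgroup_mull h x : H h -> H (h * x) <-> H x.
Proof.
move=> Hh; split=> [Hx|]; last exact: HM.
by rewrite -[x](mulKg h); apply: HM Hx; apply: HV.
Qed.

Lemma subgroup_mulr h x : H h -> H (x * h) <-> H x.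
Proof.
move=> Hh; split=> [Hx|Hx]; last exact: HM.
by rewrite -[x](mulgK h); apply: HM Hx _; apply: HV.
Qed.

Fact coset_rep_subproof x : exists y, `[< H (y * x^-1) >].
Proof. by exists x; apply/asboolP; rewrite mulgV. Qed.

Definition coset_rep x : G := xchoose (coset_rep_subproof x).

Lemma coset_repP x : H (coset_rep x * x^-1).
Proof. exact/asboolP/(xchooseP (coset_rep_subproof x)). Qed.

(** The choice depends only on the predicate defining the coset, and [x] and [h * x] define the same
    one. *)
Lemma coset_repM h x : H h -> coset_rep (h * x) = coset_rep x.
Proof.
move=> Hh; apply: eq_xchoose => y; apply/asboolP/asboolP.
  by rewrite invgM mulgA => /subgroup_mulr; apply; apply: HV.
by rewrite invgM mulgA => Hy; apply: HM => //; apply: HV.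
Qed.

(* A state (h, [:: (b1, t1); ...; (bk, tk)]) is the normal form h t1 ... tk of *)
(* an element of the amalgam, with ti a nontrivial representative of a right  *)
(* coset of H in copy bi.                                                      *)
Definition state : Type := (G * seq (bool * G))%type.

Definition starts (b : bool) (l : seq (bool * G)) : bool :=
  if l is (b', _) :: _ then b' == b else false.

(** [unpack b] multiplies a leading syllable of copy [b] back into the head, which may then be any
    element of that copy; [pack b] splits the head again into an element of [H] and a coset
    representative. Copy [b] acts by multiplying the head in between. *)
Definition unpack b (st : state) : state :=
  if st.2 is (b', t) :: l' then if b' == b then (st.1 * t, l') else st else st.

Definition pack b (st : state) : state :=
  if `[< H st.1 >] then st
  else (st.1 * (coset_rep st.1)^-1, (b, coset_rep st.1) :: st.2).

Definition amalg_act b g (st : state) : state :=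
  pack b (g * (unpack b st).1, (unpack b st).2).

Fixpoint normal (l : seq (bool * G)) : Prop :=
  if l is (b, t) :: l' then
    [/\ ~ H t, coset_rep t = t, ~~ starts b l' & normal l']
  else True.

Definition valid (st : state) : Prop := H st.1 /\ normal st.2.

Lemma coset_rep_notin x : ~ H x -> ~ H (coset_rep x).
Proof.
by move=> nHx Hr; apply: nHx; have /subgroup_mull := coset_repP x;
   move=> /(_ Hr) /HV; rewrite invgK.
Qed.

Lemma coset_repK x : coset_rep (coset_rep x) = coset_rep x.
Proof.
have E := coset_repM x (coset_repP x).
by rewrite -[in LHS](mulgVK x (coset_rep x)).
Qed.

Lemma coset_rep_quot x : H (x * (coset_rep x)^-1).
Proof. by have := HV (coset_repP x); rewrite invgM invgK. Qed.

Lemma pack_valid b st : normal st.2 -> ~~ starts b st.2 -> valid (pack b st).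
Proof.
move=> nl sl; rewrite /pack; case: asboolP => [Hx|nHx]; first by [].
split; first exact: coset_rep_quot.
by split=> //; [apply: coset_rep_notin|apply: coset_repK].
Qed.

Lemma unpack_normal b st : valid st ->
  normal (unpack b st).2 /\ ~~ starts b (unpack b st).2.
Proof.
case: st => h [|[b' t] l] [Hh /= nl] //; rewrite /unpack /=.
case: (eqVneq b' b) nl => [->|ne] [nHt rt sl nl] //=.
Qed.

Lemma packK b st : ~~ starts b st.2 -> unpack b (pack b st) = st.
Proof.
case: st => x l /= sl; rewrite /pack /=; case: asboolP => _; last first.
  by rewrite /unpack /= eqxx mulgVK.
by case: l sl => [|[b' t] l] //= /negPf nb; rewrite /unpack /= nb.
Qed.

(** An element of [H] only changes the head, since representatives are constant on cosets. The
    result does not involve [b], so both copies of [H] act alike, as the relation [DoubleH]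
    demands. *)
Lemma pack_unpack_mul b h st : H h -> valid st ->
  pack b (h * (unpack b st).1, (unpack b st).2) = (h * st.1, st.2).
Proof.
case: st => h' l Hh [/= Hh' nl].
have Hhh' : H (h * h') by exact: HM.
have packH : pack b (h * h', l) = (h * h', l).
  by rewrite /pack /=; case: asboolP.
case: l nl packH => [|[b' t] l] //=; rewrite /unpack /=.
case: eqP => [->|] //= [nHt rt _ _] _; rewrite /pack /= mulgA.
case: asboolP => [/subgroup_mull-/(_ Hhh')//|_].
by rewrite coset_repM // rt mulgK.
Qed.

Lemma amalg_act_valid b g st : valid st -> valid (amalg_act b g st).
Proof. by move=> /(unpack_normal b)[nl sl]; apply: pack_valid. Qed.

Lemma amalg_actM b g g' st : valid st ->
  amalg_act b (g * g') st = amalg_act b g (amalg_act b g' st).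
Proof.
move=> /(unpack_normal b)[nl sl].
by rewrite /amalg_act packK //= mulgA.
Qed.

Lemma amalg_act_sub b h st : H h -> valid st -> amalg_act b h st = (h * st.1, st.2).
Proof. exact: pack_unpack_mul. Qed.

Lemma amalg_act1 b st : valid st -> amalg_act b 1 st = st.
Proof. by move=> vs; rewrite amalg_act_sub // mul1g; case: st vs. Qed.

Definition letter_act (l : (G + G) * bool) : state -> state :=
  let gen b g := amalg_act b (if l.2 then g else g^-1) in
  match l.1 with inl g => gen false g | inr g => gen true g end.

Definition word_act (u : word (G + G)%type) (st : state) := foldr letter_act st u.

Lemma letter_act_valid l st : valid st -> valid (letter_act l st).
Proof. by case: l => -[g|g] b; apply: amalg_act_valid. Qed.

Lemma word_act_valid u st : valid st -> valid (word_act u st).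
Proof. by move=> vs; elim: u => //= l u; apply: letter_act_valid. Qed.

Lemma word_act_eq u v : pres_eq (double_rel H) u v ->
  forall st, valid st -> word_act u st = word_act v st.
Proof.
elim=> {u v} [u|u v _ IH|u v t _ IH1 _ IH2|u u' v v' _ IHu _ IHv|l|u v r] st vs //.
- by rewrite IH.
- by rewrite IH1 ?IH2.
- rewrite /word_act !foldr_cat; have := IHv st vs; rewrite /word_act => ->.
  exact/IHu/word_act_valid.
- case: l => -[g|g] []; rewrite /word_act /letter_act /=;
  by rewrite -amalg_actM // ?mulgV ?mulVg amalg_act1.
case: r => [x y|x y|h Hh]; rewrite /word_act /letter_act /=.
- by rewrite -amalg_actM.
- by rewrite -amalg_actM.
- by rewrite !amalg_act_sub.
Qed.

Definition double_act (d : D) : state -> state := 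
  word_act (repr (d : {eq_quot pg_equiv (pres_pregroup (double_rel H))})).

Lemma double_act_class u st : valid st ->
  double_act (presented_class (double_rel H) u) st = word_act u st.
Proof. exact/word_act_eq/(@pg_class_repr (pres_pregroup (double_rel H))). Qed.

Lemma double_act_valid d st : valid st -> valid (double_act d st).
Proof. exact: word_act_valid. Qed.

Lemma double_actM d d' st : valid st ->
  double_act (d * d') st = double_act d (double_act d' st).
Proof.
have [u <-] := presented_class_surj d; have [v <-] := presented_class_surj d'.
move=> vs; rewrite -presented_class_cat !double_act_class //.
  by rewrite /word_act foldr_cat.
exact: word_act_valid.
Qed.

Lemma double_act_in b g st : valid st -> double_act (amalg_in b g) st = amalg_act b g st.
Proof. by move=> vs; rewrite /amalg_in double_act_class //; case: b. Qed.

Lemma double_act1 st : valid st -> double_act 1 st = st.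
Proof. by move=> vs; rewrite -presented_class_nil double_act_class. Qed.

Definition state1 : state := (1, [::]).

Lemma state1_valid : valid state1. Proof. by []. Qed.

(** With [amalg_act_neq1] this replaces the normal form theorem: alternating factors outside [H]
    pile up syllables and never cancel. *)
Lemma amalg_act_starts b g st : ~ H g -> valid st -> ~~ starts b st.2 ->
  starts b (amalg_act b g st).2.
Proof.
case: st => h l nHg [/= Hh nl] sl; rewrite /amalg_act.
have -> : unpack b (h, l) = (h, l).
  by case: l sl {nl} => [|[b' t] l] //= /negPf nb; rewrite /unpack /= nb.
by rewrite /pack /=; case: asboolP => [/subgroup_mulr-/(_ Hh)//|_] /=.
Qed.

Lemma amalg_act_state1 b g : ~~ starts (~~ b) (amalg_act b g state1).2.
Proof. by rewrite /amalg_act /pack /=; case: asboolP => //= _; case: b. Qed.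

Lemma amalg_act_neq1 b g st : starts (~~ b) st.2 -> amalg_act b g st <> state1.
Proof.
case: st => h [|[b' t] l] //= /eqP ->; rewrite /amalg_act /unpack /=.
have -> : (~~ b == b) = false by case: b.
by rewrite /pack /=; case: asboolP.
Qed.

Lemma amalg_in_inj b : injective (amalg_in b).
Proof.
apply: (morph_mul_inj (@amalg_inM b)) => g /(congr1 (double_act^~ state1)).
have v1 := state1_valid; rewrite double_act_in // double_act1 //.
rewrite /amalg_act /= /pack /=.
by case: asboolP => // _ [<-]; rewrite mulg1.
Qed.

End Amalgam.

Section CyclicSubgroup.
Variables (G : groupType) (w : G).

Lemma cyclic_subgroup1 : cyclic_subgroup w 1.
Proof. by exists 0%N; left. Qed.

Lemma cyclic_subgroupV g : cyclic_subgroup w g -> cyclic_subgroup w g^-1.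
Proof. by case=> k [->|->]; exists k; [right|left; rewrite invgK]. Qed.

Lemma cyclic_subgroupM g h :
  cyclic_subgroup w g -> cyclic_subgroup w h -> cyclic_subgroup w (g * h).
Proof.
have sub i j : cyclic_subgroup w (w ^+ i * w ^- j).
  have [ij|/ltnW ji] := leqP i j; last by exists (i - j)%N; left; rewrite expgnFr.
  exists (j - i)%N; right; rewrite expgnFr // invgM invgK //.
case=> i [->|->] [j [->|->]].
- by exists (i + j)%N; left; rewrite expgnDr.
- exact: sub.
- have := sub j i; rewrite (commuteV (commuteX2 j i (commute_refl w))).
  by [].
- by exists (i + j)%N; right; rewrite addnC expgnDr invgM.
Qed.

End CyclicSubgroup.

(** * Homotopy of paths in a surface *)

Section PathHomotopy.
Variables (S : surface) (v : corner S).
Implicit Types (x y z : corner S) (p q r : seq (dart S)) (d : dart S).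

Lemma same_vertex_refl x : same_vertex x x.
Proof. exact: connect0. Qed.

Lemma is_path_eqr x p y y' : same_vertex y y' -> is_path x p y = is_path x p y'.
Proof.
move=> yy'; elim: p x => [|d p IHp] x /=; last by rewrite IHp.
by rewrite !(same_vertex_sym x) -!/(is_path _ [::] _) (is_path_eql _ _ yy').
Qed.

Lemma is_path_catP x p q z :
  reflect (exists2 y, is_path x p y & is_path y q z) (is_path x (p ++ q) z).
Proof.
apply: (iffP idP) => [|[y]]; last exact: is_path_cat.
elim: p x => [|d p IHp] x /=; first by exists x => //; apply: connect0.
by case/andP=> -> /IHp.
Qed.

Lemma is_path1 d : is_path (dart_src d) [:: d] (dart_tgt d).
Proof. by rewrite /= !same_vertex_refl. Qed.

(* The context closure is what makes a homotopy rel endpoints usable inside  *)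
(* loops at the base point v.                                                *)
Definition path_homotopic x y p q : Prop :=
  [/\ is_path x p y, is_path x q y &
      forall u t, is_path v u x -> is_path y t v ->
      forall a b : loop v, val a = u ++ p ++ t -> val b = u ++ q ++ t ->
      homotopic a b].

Lemma path_homotopic_refl x y p : is_path x p y -> path_homotopic x y p p.
Proof. by move=> pP; split=> // u t _ _ a b <- /esym; apply: homotopic_val. Qed.

Lemma path_homotopic_sym x y p q : path_homotopic x y p q -> path_homotopic x y q p.
Proof.
by case=> pP qP pq; split=> // u t uP tP a b Ea Eb; apply/HomSym/(pq u t).
Qed.

Lemma path_homotopic_trans x y p q r :
  path_homotopic x y p q -> path_homotopic x y q r -> path_homotopic x y p r.
Proof.
case=> pP qP pq [_ rP qr]; split=> // u t uP tP a b Ea Eb.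
have cP : is_path v (u ++ q ++ t) v by apply: is_path_cat uP (is_path_cat qP tP).
pose c : loop v := exist (fun p => is_path v p v) _ cP.
by apply: (@HomTrans _ _ a c b); [apply: (pq u t)|apply: (qr u t)].
Qed.

Lemma path_homotopic_cat x y z p p' q q' :
  path_homotopic x y p p' -> path_homotopic y z q q' ->
  path_homotopic x z (p ++ q) (p' ++ q').
Proof.
case=> pP p'P pp' [qP q'P qq'].
apply: (@path_homotopic_trans _ _ _ (p' ++ q)); split;
  try (by apply: is_path_cat; eassumption); move=> u t uP tP a b Ea Eb.
- by apply: (pp' u (q ++ t)) => //; rewrite ?Ea ?Eb -?catA //; apply: is_path_cat qP tP.
- by apply: (qq' (u ++ p') t) => //; rewrite ?Ea ?Eb -?catA //; apply: is_path_cat uP p'P.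
Qed.

Lemma path_homotopic_catl x y z p q q' :
  is_path x p y -> path_homotopic y z q q' -> path_homotopic x z (p ++ q) (p ++ q').
Proof. by move=> /path_homotopic_refl; apply: path_homotopic_cat. Qed.

Lemma path_homotopic_catr x y z p p' q :
  is_path y q z -> path_homotopic x y p p' -> path_homotopic x z (p ++ q) (p' ++ q).
Proof. by move=> /path_homotopic_refl qq pp'; apply: path_homotopic_cat pp' qq. Qed.

Lemma path_homotopic_eql x x' y p q : same_vertex x x' ->
  path_homotopic x y p q -> path_homotopic x' y p q.
Proof.
move=> xx' [pP qP pq]; split; rewrite -?(is_path_eql _ _ xx') //.
by move=> u t; rewrite -(is_path_eqr _ _ xx'); apply: pq.
Qed.

Lemma path_homotopic_eqr x y y' p q : same_vertex y y' ->
  path_homotopic x y p q -> path_homotopic x y' p q.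
Proof.
move=> yy' [pP qP pq]; split; rewrite -?(is_path_eqr _ _ yy') //.
by move=> u t uP; rewrite -(is_path_eql _ _ yy'); apply: pq.
Qed.

Lemma path_homotopic_move x y p q : is_path x p y -> is_path x q y ->
  elementary_move p q -> path_homotopic x y p q.
Proof.
by move=> pP qP pq; split=> // u t _ _ a b Ea Eb; apply: HomMove Ea Eb pq.
Qed.

Lemma path_homotopic_spur d :
  path_homotopic (dart_src d) (dart_src d) [:: d; dart_rev d] [::].
Proof.
apply: path_homotopic_move (MoveSpur d); rewrite /= ?same_vertex_refl //.
by rewrite /dart_tgt dart_revK !same_vertex_refl.
Qed.

Lemma dart_rev_mate d : dart_rev (dart_mate d) = dart_mate (dart_rev d).
Proof. by case: d => s b; rewrite /dart_rev /dart_mate /= addNb. Qed.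

Lemma dart_src_mate d : same_vertex (dart_src d) (dart_src (dart_mate d)).
Proof. by apply/connect1/existsP; exists d; rewrite !eqxx. Qed.

Lemma dart_tgt_mate d : same_vertex (dart_tgt d) (dart_tgt (dart_mate d)).
Proof. by rewrite /dart_tgt dart_rev_mate; apply: dart_src_mate. Qed.

Lemma path_homotopic_mate d :
  path_homotopic (dart_src d) (dart_tgt d) [:: d] [:: dart_mate d].
Proof.
apply: path_homotopic_move (MoveGlue d); first exact: is_path1.
by rewrite /= dart_src_mate same_vertex_sym dart_tgt_mate.
Qed.

Lemma path_rev_cat p q : path_rev (p ++ q) = path_rev q ++ path_rev p.
Proof. by rewrite /path_rev map_cat rev_cat. Qed.

Lemma path_homotopic_mulgV x y p : is_path x p y ->
  path_homotopic x x (p ++ path_rev p) [::].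
Proof.
elim: p x => [|d p IHp] x; first by rewrite /= => _; apply: path_homotopic_refl; apply: connect0.
case/andP=> xd /IHp pp.
rewrite -cat1s path_rev_cat catA -(catA [:: d]).
have Et : path_rev [:: d] = [:: dart_rev d] by [].
rewrite same_vertex_sym in xd.
apply: (path_homotopic_eql xd); apply: (path_homotopic_eqr xd).
apply: path_homotopic_trans (path_homotopic_spur d).
rewrite Et -[[:: d; dart_rev d]]/([:: d] ++ [::] ++ [:: dart_rev d]) -[X in path_homotopic _ _ X]catA.
apply: path_homotopic_catl (is_path1 d) _.
apply: path_homotopic_catr pp.
by have := is_path1 (dart_rev d); rewrite /dart_tgt dart_revK.
Qed.

Lemma path_homotopic_rev x y p q :
  path_homotopic x y p q -> path_homotopic y x (path_rev p) (path_rev q).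
Proof.
move=> pq; have [pP qP _] := pq.
have rpP := is_path_rev pP; have rqP := is_path_rev qP.
apply: (@path_homotopic_trans _ _ _ (path_rev p ++ q ++ path_rev q)).
  apply: path_homotopic_sym; rewrite -[X in path_homotopic _ _ _ X]cats0.
  exact: path_homotopic_catl rpP (path_homotopic_mulgV qP).
apply: (@path_homotopic_trans _ _ _ (path_rev p ++ p ++ path_rev q)).
  apply: path_homotopic_catl rpP _; apply: path_homotopic_catr rqP _.
  exact: path_homotopic_sym.
rewrite catA -[X in path_homotopic _ _ _ X]cat0s.
apply: path_homotopic_catr rqP _.
by have := path_homotopic_mulgV rpP; rewrite path_revK.
Qed.

Lemma path_homotopic_mulVg x y p : is_path x p y ->
  path_homotopic y y (path_rev p ++ p) [::].
Proof. by move=> /is_path_rev/path_homotopic_mulgV; rewrite path_revK. Qed.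

Lemma path_homotopic_loop (a b : loop v) :
  path_homotopic v v (val a) (val b) -> homotopic a b.
Proof.
by case=> _ _ /(_ [::] [::]); apply; rewrite /= ?cats0 //; apply: connect0.
Qed.

Lemma path_homotopic_divg x y p q : is_path x p y -> is_path x q y ->
  path_homotopic y y (path_rev p ++ q) [::] -> path_homotopic x y q p.
Proof.
move=> pP qP pq; apply: (@path_homotopic_trans _ _ _ (p ++ path_rev p ++ q)).
  rewrite catA -[X in path_homotopic _ _ X]cat0s.
  by apply/(path_homotopic_catr qP)/path_homotopic_sym/path_homotopic_mulgV/pP.
rewrite -[X in path_homotopic _ _ _ X]cats0; exact: path_homotopic_catl pP pq.
Qed.

Lemma path_homotopic_divgr x y p q : is_path x p y -> is_path x q y ->
  path_homotopic x x (p ++ path_rev q) [::] -> path_homotopic x y p q.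
Proof.
move=> pP qP pq; apply: (@path_homotopic_trans _ _ _ ((p ++ path_rev q) ++ q)).
  rewrite -catA -[X in path_homotopic _ _ X]cats0.
  by apply/(path_homotopic_catl pP)/path_homotopic_sym/path_homotopic_mulVg/qP.
rewrite -[X in path_homotopic _ _ _ X]cat0s; exact: path_homotopic_catr qP pq.
Qed.

Lemma path_homotopic_swap x y y' z p q p' q' :
  is_path x p y -> is_path y q z -> is_path x p' y' -> is_path y' q' z ->
  path_homotopic x z (p ++ q) (p' ++ q') ->
  path_homotopic y y' (path_rev p ++ p') (q ++ path_rev q').
Proof.
move=> pP qP p'P q'P pq.
have rpP := is_path_rev pP; have rq'P := is_path_rev q'P.
apply: (@path_homotopic_trans _ _ _ (path_rev p ++ (p' ++ q') ++ path_rev q')).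
  apply: (path_homotopic_catl rpP); rewrite -catA -[X in path_homotopic _ _ X]cats0.
  by apply/(path_homotopic_catl p'P)/path_homotopic_sym/path_homotopic_mulgV/q'P.
apply: (@path_homotopic_trans _ _ _ (path_rev p ++ (p ++ q) ++ path_rev q')).
  apply: (path_homotopic_catl rpP); apply: (path_homotopic_catr rq'P).
  exact: path_homotopic_sym.
rewrite -!catA catA -[X in path_homotopic _ _ _ X]cat0s.
apply: path_homotopic_catr (path_homotopic_mulVg pP); exact: is_path_cat qP rq'P.
Qed.

End PathHomotopy.

(** * The double of a punctured surface *)

(** Bounds the number of vertices once every vertex is known to have at least [k] corners. *)
Lemma n_comp_leq (T : finType) (e : rel T) k : connect_sym e ->
  (forall x, (k <= #|[pred y | connect e x y]|)%N) ->
  (n_comp e [pred x : T | true] * k <= #|T|)%N.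
Proof.
move=> sym_e le_k.
have -> : (n_comp e [pred x : T | true] * k = \sum_(r | roots e r) k)%N.
  by rewrite -sum_nat_const; apply: eq_bigl => r; rewrite !inE andbT.
rewrite -[#|T|]sum1_card [X in (_ <= X)%N](partition_big (fingraph.root e) (roots e)) /=; last first.
  by move=> x _; apply: roots_root.
apply: leq_sum => r /eqP rr; apply: leq_trans (le_k r) _.
rewrite -sum1_card; apply: eq_leq; apply: eq_bigl => x; rewrite !inE.
by rewrite -(root_connect sym_e) rr eq_sym.
Qed.

Lemma map_cat_cons2 (T U : Type) (f : T -> U) p u1 l l' u2 :
  map f p = u1 ++ [:: l, l' & u2] ->
  exists p1 d d' p2, p = p1 ++ [:: d, d' & p2] /\ f d = l /\ f d' = l'.
Proof.
elim: u1 p => [|m u1 IHu] [|d p] //=.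
  by case: p => // d' p [<- <- _]; exists [::], d, d', p.
by case=> _ /IHu[p1 [e [e' [p2 [-> [? ?]]]]]]; exists (d :: p1), e, e', p2.
Qed.

Lemma fcard_involution (T : finType) (f : T -> T) : involutive f ->
  (forall x, f x != x) -> (fcard f [pred x : T | true] * 2 = #|T|)%N.
Proof.
move=> fK f_neq; apply: (@fcard_order_set _ f (inv_inj fK)) => //.
apply/subsetP => x _; rewrite inE.
by rewrite (@order_cycle _ f [:: x; f x]) //= ?fK ?inE ?eqxx // andbT eq_sym f_neq.
Qed.

(** * The double as a surface tiled by squares *)

Section Pairing.
Variables (Q : finType) (nx mt : Q -> Q) (fl : Q -> bool).

(** The dart calculus of a [surface], restated for a bare finite set of sides with successor [nx],
    partner [mt] and flip [fl]. This lets the construction apply to a reoriented component without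
    first making it a [surface]. *)
Definition qsrc (d : Q * bool) := if d.2 then d.1 else nx d.1.
Definition qrev (d : Q * bool) := (d.1, ~~ d.2).
Definition qmate (d : Q * bool) := (mt d.1, d.2 (+) fl d.1).
Definition qglue : rel Q :=
  fun x y => [exists d, (x == qsrc d) && (y == qsrc (qmate d))].
Definition qvert : rel Q := connect qglue.

Definition o0 : 'I_4 := @Ordinal 4 0 isT.
Definition o1 : 'I_4 := @Ordinal 4 1 isT.
Definition o2 : 'I_4 := @Ordinal 4 2 isT.
Definition o3 : 'I_4 := @Ordinal 4 3 isT.

Lemma ord4_ind (P : 'I_4 -> Prop) : P o0 -> P o1 -> P o2 -> P o3 -> forall k, P k.
Proof.
move=> P0 P1 P2 P3 [[|[|[|[|k]]]] lt_k] //.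
- by have -> : Ordinal lt_k = o0 by apply: val_inj.
- by have -> : Ordinal lt_k = o1 by apply: val_inj.
- by have -> : Ordinal lt_k = o2 by apply: val_inj.
- by have -> : Ordinal lt_k = o3 by apply: val_inj.
Qed.

Definition square_side : finType := {i : 'I_#|Q| & 'I_4}.
Definition sq (s : Q) (k : 'I_4) : square_side :=
  Tagged (fun _ : 'I_#|Q| => 'I_4) (i := enum_rank s) k.
Definition base (t : square_side) : Q := enum_val (tag t).
Definition pos (t : square_side) : 'I_4 := tagged t.

Arguments sq : simpl never.
Arguments base : simpl never.
Arguments pos : simpl never.

Lemma base_sq s k : base (sq s k) = s. Proof. exact: enum_rankK. Qed.
Lemma pos_sq s k : pos (sq s k) = k. Proof. by []. Qed.

Lemma sq_ind (P : square_side -> Prop) :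
  (forall s, P (sq s o0)) -> (forall s, P (sq s o1)) ->
  (forall s, P (sq s o2)) -> (forall s, P (sq s o3)) -> forall t, P t.
Proof.
move=> P0 P1 P2 P3 [i k]; have := P3 (enum_val i); have := P2 (enum_val i).
have := P1 (enum_val i); have := P0 (enum_val i).
by rewrite /sq enum_valK /=; elim/ord4_ind: k.
Qed.

Lemma sq_eq s s' k k' : (sq s k == sq s' k') = (s == s') && (k == k').
Proof.
apply/eqP/andP=> [E|[/eqP-> /eqP->]] //.
by rewrite -(base_sq s k) -(base_sq s' k') -(pos_sq s k) -(pos_sq s' k') E !eqxx.
Qed.

Definition square_mate (t : square_side) : square_side :=
  match val (pos t) with
  | 0 => sq (mt (base t)) o0
  | 1 => sq (nx (base t)) o3
  | 2 => sq (mt (base t)) o2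
  | _ => sq (finv nx (base t)) o1
  end.

(** Round a square, side 1 goes up and side 3 goes down, so these are always glued with a reversal;
    the copies of a side are glued as the side itself is. *)
Definition square_flip (t : square_side) : bool := odd (pos t) || fl (base t).

Hypotheses (nxI : injective nx) (mtK : involutive mt)
  (mt_neq : forall s, mt s != s) (fl_mt : forall s, fl (mt s) = fl s).

Lemma square_mate0 s : square_mate (sq s o0) = sq (mt s) o0.
Proof. by rewrite -[in RHS](base_sq s o0). Qed.
Lemma square_mate1 s : square_mate (sq s o1) = sq (nx s) o3.
Proof. by rewrite -[in RHS](base_sq s o1). Qed.
Lemma square_mate2 s : square_mate (sq s o2) = sq (mt s) o2.
Proof. by rewrite -[in RHS](base_sq s o2). Qed.
Lemma square_mate3 s : square_mate (sq s o3) = sq (finv nx s) o1.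
Proof. by rewrite -[in RHS](base_sq s o3). Qed.
Definition square_mateE := (square_mate0, square_mate1, square_mate2, square_mate3).

Lemma square_flip_sq s k : square_flip (sq s k) = odd k || fl s.
Proof. by rewrite /square_flip pos_sq base_sq. Qed.

Lemma square_mateK : involutive square_mate.
Proof. by elim/sq_ind=> s; rewrite !square_mateE ?mtK ?f_finv ?finv_f. Qed.

Lemma square_mate_neq t : square_mate t != t.
Proof.
by elim/sq_ind: t=> s; rewrite !square_mateE sq_eq negb_and ?mt_neq // orbT.
Qed.

Lemma square_flip_mate t : square_flip (square_mate t) = square_flip t.
Proof. by elim/sq_ind: t=> s; rewrite !square_mateE !square_flip_sq ?fl_mt. Qed.

(* The double of the surface obtained from the side-pairing by removing an    *)
(* open disk from each face.  The annulus along a face is cut into one square *)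
(* for each side s, whose sides 0 and 2 are the copies of s, and whose sides  *)
(* 1 and 3 join the two copies of the corners nx s and s.                     *)
Definition double_surface : surface :=
  @Surface #|Q| (fun _ => 4) (fun _ => isT) square_mate square_mateK
    square_mate_neq square_flip square_flip_mate.

Local Notation DS := double_surface.

(** Sides 0 and 1 start in copy 0, sides 2 and 3 in copy 1; sides 0 and 3 start over the corner [s],
    sides 1 and 2 over [nx s]. *)
Definition level (t : corner DS) : bool := (1 < pos t)%N.
Definition qcorner (t : corner DS) : Q :=
  if (pos t == o0) || (pos t == o3) then base t else nx (base t).
Definition lift_corner (c : Q) (b : bool) : corner DS := sq c (if b then o3 else o0).
Definition horizontal (d : dart DS) : bool := ~~ odd (pos d.1).
(** Side 2 of a square runs against the direction of the side it copies, which accounts for the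
    exclusive or here and in [lift_dart]. *)
Definition qdart (d : dart DS) : Q * bool := (base d.1, d.2 (+) (pos d.1 == o2)).
Definition lift_dart (d : Q * bool) (b : bool) : dart DS :=
  (sq d.1 (if b then o2 else o0), d.2 (+) b).
Definition vertical_dart (c : Q) (b : bool) : dart DS := (sq c o3, b).

Lemma level_lift c b : level (lift_corner c b) = b.
Proof. by rewrite /level pos_sq; case: b. Qed.

Lemma qcorner_lift c b : qcorner (lift_corner c b) = c.
Proof. by rewrite /qcorner pos_sq base_sq; case: b. Qed.

Lemma next_sq0 s : next_side (S := DS) (sq s o0) = sq s o1.
Proof. by congr (Tagged _ _); apply: val_inj. Qed.
Lemma next_sq1 s : next_side (S := DS) (sq s o1) = sq s o2.
Proof. by congr (Tagged _ _); apply: val_inj. Qed.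
Lemma next_sq2 s : next_side (S := DS) (sq s o2) = sq s o3.
Proof. by congr (Tagged _ _); apply: val_inj. Qed.
Lemma next_sq3 s : next_side (S := DS) (sq s o3) = sq s o0.
Proof. by congr (Tagged _ _); apply: val_inj. Qed.
Definition next_sq := (next_sq0, next_sq1, next_sq2, next_sq3).

Lemma src_lift_corner x : same_vertex x (lift_corner (qcorner x) (level x)).
Proof.
elim/sq_ind: x => s; rewrite /qcorner /level pos_sq base_sq /=.
- exact: same_vertex_refl.
- apply: connect1; apply/existsP; exists (sq s o1, true) => /=.
  by rewrite /dart_src /dart_mate /= ?square_flip_sq square_mateE /= ?next_sq !eqxx.
- apply: connect1; apply/existsP; exists (sq s o1, false) => /=.
  by rewrite /dart_src /dart_mate /= ?square_flip_sq square_mateE /= ?next_sq !eqxx.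
- exact: same_vertex_refl.
Qed.

Lemma same_vertex_qvert x y : same_vertex x y ->
  level x = level y /\ qvert (qcorner x) (qcorner y).
Proof.
case/connectP=> p; elim: p x => [|z p IHp] x /=; first by move=> _ ->; split=> //; apply: connect0.
case/andP=> /existsP[[t b] /andP[/eqP-> /eqP Ez]] zp yp.
have [<- vz] := IHp z zp yp.
suff [-> E]: level (dart_src (t, b)) = level z /\ qvert (qcorner (dart_src (t, b))) (qcorner z).
  by split=> //; apply: connect_trans E vz.
rewrite {z zp IHp yp vz}Ez /dart_mate /dart_src /level /qcorner /=.
elim/sq_ind: t => s; rewrite ?square_flip_sq square_mateE /=.
- split; first by case: b; case: (fl s) => /=; rewrite ?next_sq ?pos_sq.
  apply: connect1; apply/existsP; exists (s, b); rewrite /qsrc /qmate /=.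
  by case: b; case: (fl s); rewrite /= ?next_sq ?pos_sq ?base_sq /= ?base_sq !eqxx.
- by case: b; rewrite /= ?next_sq ?pos_sq ?base_sq /= ?base_sq /qvert connect0.
- split; first by case: b; case: (fl s) => /=; rewrite ?next_sq ?pos_sq.
  apply: connect1; apply/existsP; exists (s, ~~ b); rewrite /qsrc /qmate /=.
  by case: b; case: (fl s); rewrite /= ?next_sq ?pos_sq ?base_sq /= ?base_sq !eqxx.
- by case: b; rewrite /= ?next_sq ?pos_sq ?base_sq /= ?base_sq ?f_finv // /qvert connect0.
Qed.

Lemma src_lift_dart d b :
  same_vertex (dart_src (lift_dart d b)) (lift_corner (qsrc d) b).
Proof.
have := src_lift_corner (dart_src (lift_dart d b)).
suff [-> ->]: qcorner (dart_src (lift_dart d b)) = qsrc d /\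
  level (dart_src (lift_dart d b)) = b by [].
rewrite /dart_src /lift_dart /qsrc /qcorner /level /=.
by case: d => s []; case: b => /=; rewrite ?next_sq ?pos_sq ?base_sq.
Qed.

Lemma mate_lift_dart d b : dart_mate (lift_dart d b) = lift_dart (qmate d) b.
Proof.
case: d => s e; rewrite /dart_mate /lift_dart /qmate /=; congr pair.
  by case: b; rewrite square_mateE.
by case: b; rewrite square_flip_sq //= addbAC.
Qed.

Lemma qvert_same_vertex c c' b : qvert c c' ->
  same_vertex (lift_corner c b) (lift_corner c' b).
Proof.
case/connectP=> p; elim: p c => [|z p IHp] c /=; first by move=> _ ->; apply: same_vertex_refl.
case/andP=> /existsP[[s e] /andP[/eqP-> /eqP Ez]] zp yp.
apply: same_vertex_trans (IHp z zp yp).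
have := dart_src_mate (lift_dart (s, e) b).
rewrite mate_lift_dart Ez => E.
apply: same_vertex_trans (same_vertex_trans E (src_lift_dart _ _)).
by rewrite same_vertex_sym src_lift_dart.
Qed.

(** The vertices of the double are two disjoint copies of the original vertices. *)
Lemma same_vertexE x y :
  same_vertex x y <-> level x = level y /\ qvert (qcorner x) (qcorner y).
Proof.
split; first exact: same_vertex_qvert.
case=> lxy vxy; apply: same_vertex_trans (src_lift_corner x) _.
rewrite lxy; apply: same_vertex_trans (qvert_same_vertex _ vxy) _.
by rewrite same_vertex_sym; apply: src_lift_corner.
Qed.


Lemma horizontal_lift d b : horizontal (lift_dart d b).
Proof. by rewrite /horizontal /= pos_sq; case: b. Qed.

Lemma qdart_lift d b : qdart (lift_dart d b) = d.
Proof. by case: d => s e; rewrite /qdart /= pos_sq base_sq; case: b; rewrite /= addbK. Qed.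

Lemma level_src_lift d b : level (dart_src (lift_dart d b)) = b.
Proof.
by have [-> _] := same_vertex_qvert (src_lift_dart d b); apply: level_lift.
Qed.

Lemma lift_qdart d : horizontal d -> d = lift_dart (qdart d) (level (dart_src d)).
Proof.
rewrite /horizontal; case: d => t b /=; elim/sq_ind: t => s; rewrite pos_sq //= => _;
  rewrite /qdart /lift_dart /level /dart_src /= base_sq pos_sq /=;
  by case: b; rewrite ?next_sq.
Qed.

Lemma rev_lift_dart d b : dart_rev (lift_dart d b) = lift_dart (qrev d) b.
Proof. by case: d => s e; rewrite /dart_rev /lift_dart /qrev /= addNb. Qed.

Lemma tgt_lift_dart d b :
  same_vertex (dart_tgt (lift_dart d b)) (lift_corner (qsrc (qrev d)) b).
Proof. by rewrite /dart_tgt rev_lift_dart src_lift_dart. Qed.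

Lemma src_vertical_dart c b : dart_src (vertical_dart c b) = lift_corner c b.
Proof. by rewrite /dart_src /= next_sq; case: b. Qed.

Lemma rev_vertical_dart c b : dart_rev (vertical_dart c b) = vertical_dart c (~~ b).
Proof. by []. Qed.

Lemma tgt_vertical_dart c b : dart_tgt (vertical_dart c b) = lift_corner c (~~ b).
Proof. by rewrite /dart_tgt rev_vertical_dart src_vertical_dart. Qed.

Lemma vertical_dartE d : ~~ horizontal d ->
  let e := vertical_dart (qcorner (dart_src d)) (level (dart_src d)) in
  d = e \/ dart_mate d = e.
Proof.
rewrite /horizontal negbK; case: d => t b /=; elim/sq_ind: t => s; rewrite pos_sq //= => _;
  rewrite /vertical_dart /dart_mate /dart_src /=.
- right; rewrite square_mateE square_flip_sq; case: b;
  by rewrite ?next_sq /qcorner /level ?pos_sq ?base_sq.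
- by left; case: b; rewrite ?next_sq /qcorner /level ?pos_sq ?base_sq.
Qed.

Lemma level_tgt_vertical d : ~~ horizontal d ->
  level (dart_tgt d) = ~~ level (dart_src d).
Proof.
rewrite /horizontal negbK; case: d => t b /=; elim/sq_ind: t => s; rewrite pos_sq //= => _;
by rewrite /dart_tgt /dart_src /level /=; case: b; rewrite /= ?next_sq ?pos_sq.
Qed.

Lemma qcorner_tgt_vertical d : ~~ horizontal d ->
  qcorner (dart_tgt d) = qcorner (dart_src d).
Proof.
rewrite /horizontal negbK; case: d => t b /=; elim/sq_ind: t => s; rewrite pos_sq //= => _;
by rewrite /dart_tgt /dart_src /qcorner /=; case: b; rewrite /= ?next_sq ?pos_sq ?base_sq.
Qed.

Lemma level_tgt_horizontal d : horizontal d ->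
  level (dart_tgt d) = level (dart_src d).
Proof.
by move=> /lift_qdart ->; rewrite /dart_tgt rev_lift_dart !level_src_lift.
Qed.

Lemma poly_boundary_square s : poly_boundary (S := DS) (enum_rank s) =
  [:: (sq s o0, true); (sq s o1, true); (sq s o2, true); (sq s o3, true)].
Proof.
rewrite /poly_boundary.
suff -> : enum 'I_4 = [:: o0; o1; o2; o3] by [].
by apply: (inj_map val_inj); rewrite val_enum_ord.
Qed.

(** * Pushing paths across the annulus of a face *)

Section Homotopies.
Variable v : corner DS.

Lemma vertical_homotopic d : ~~ horizontal d ->
  path_homotopic v (dart_src d) (dart_tgt d) [:: d]
    [:: vertical_dart (qcorner (dart_src d)) (level (dart_src d))].
Proof.
move=> /vertical_dartE[<-|<-]; last exact: path_homotopic_mate.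
exact/path_homotopic_refl/is_path1.
Qed.

Lemma is_path_lift1 d b :
  is_path (lift_corner (qsrc d) b) [:: lift_dart d b] (lift_corner (qsrc (qrev d)) b).
Proof. by rewrite /= tgt_lift_dart same_vertex_sym src_lift_dart. Qed.

Lemma is_path_vertical1 c b :
  is_path (lift_corner c b) [:: vertical_dart c b] (lift_corner c (~~ b)).
Proof. by rewrite /= src_vertical_dart tgt_vertical_dart !same_vertex_refl. Qed.

Lemma square_homotopic s b :
  path_homotopic v (lift_corner s b) (lift_corner (nx s) (~~ b))
    [:: vertical_dart s b; lift_dart (s, true) (~~ b)]
    [:: lift_dart (s, true) b; vertical_dart (nx s) b].
Proof.
have lP b' : is_path (lift_corner s b') [:: lift_dart (s, true) b'] (lift_corner (nx s) b').
  exact: (is_path_lift1 (s, true)).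
have vP b' : is_path (lift_corner s b') [:: vertical_dart s b'] (lift_corner s (~~ b')).
  exact: is_path_vertical1.
have vnP b' : is_path (lift_corner (nx s) b') [:: vertical_dart (nx s) b']
    (lift_corner (nx s) (~~ b')).
  exact: is_path_vertical1.
have E0 : path_homotopic v (lift_corner s false) (lift_corner (nx s) true)
    [:: lift_dart (s, true) false; vertical_dart (nx s) false]
    [:: vertical_dart s false; lift_dart (s, true) true].
  apply: path_homotopic_divgr; first exact: is_path_cat (lP false) (vnP false).
    exact: is_path_cat (vP false) (lP true).
  have qP : is_path (lift_corner (nx s) true)
      [:: dart_rev (lift_dart (s, true) true); vertical_dart s true] (lift_corner s false).
    exact: is_path_cat (is_path_rev (lP true)) (vP true).
  have m1 : dart_mate (S := DS) (sq s o1, true) = vertical_dart (nx s) false.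
    by rewrite /dart_mate /= square_mateE.
  (* The loop to contract is the boundary of the square of [s], with side 1 replaced by its mate,
     side 3 of the next square. *)
  apply: path_homotopic_trans (_ : path_homotopic _ _ _ (poly_boundary (S := DS) (enum_rank s)) _).
    rewrite poly_boundary_square /=; apply: (path_homotopic_catl (lP false)).
    apply: (@path_homotopic_catr _ _ _ _ _ [:: vertical_dart (nx s) false] [:: (sq s o1, true)] _ qP).
    apply: path_homotopic_sym.
    have srcE : same_vertex (dart_src (S := DS) (sq s o1, true)) (lift_corner (nx s) false).
      by apply: same_vertex_trans (dart_src_mate _) _; rewrite m1 src_vertical_dart same_vertex_refl.
    have tgtE : same_vertex (dart_tgt (S := DS) (sq s o1, true)) (lift_corner (nx s) true).
      by apply: same_vertex_trans (dart_tgt_mate _) _; rewrite m1 tgt_vertical_dart same_vertex_refl.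
    apply: (path_homotopic_eql srcE); apply: (path_homotopic_eqr tgtE).
    by rewrite -m1; apply: path_homotopic_mate.
  apply: path_homotopic_move (MoveDisk _); last exact: same_vertex_refl.
  rewrite poly_boundary_square.
  have -> : lift_corner s false = dart_src (S := DS) (sq s o0, true) by [].
  rewrite /= /dart_tgt /dart_src /= !next_sq !same_vertex_refl //=.
(* Starting from the other copy gives the same relation of the square, rearranged. *)
case: b; last exact: path_homotopic_sym E0.
exact: path_homotopic_swap (vP false) (lP true) (lP false) (vnP false) (path_homotopic_sym E0).
Qed.

Fixpoint forward (c : Q) (m : nat) (b : bool) : seq (dart DS) :=
  if m is m'.+1 then lift_dart (c, true) b :: forward (nx c) m' b else [::].

Lemma is_path_forward c m b :
  is_path (lift_corner c b) (forward c m b) (lift_corner (iter m nx c) b).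
Proof.
elim: m c => [|m IHm] c; first exact: same_vertex_refl.
rewrite iterSr; apply: (is_path_cat (is_path_lift1 (c, true) b)); exact: IHm.
Qed.

Lemma annulus_homotopic c m b :
  path_homotopic v (lift_corner c b) (lift_corner (iter m nx c) (~~ b))
    (vertical_dart c b :: forward c m (~~ b))
    (forward c m b ++ [:: vertical_dart (iter m nx c) b]).
Proof.
elim: m c => [|m IHm] c; first exact/path_homotopic_refl/is_path_vertical1.
rewrite iterSr.
apply: path_homotopic_trans
  (path_homotopic_catr (is_path_forward _ _ _) (square_homotopic c b)) _.
exact: path_homotopic_catl (is_path_lift1 (c, true) b) (IHm (nx c)).
Qed.

Lemma bulge_homotopic c m b :
  path_homotopic v (lift_corner c b) (lift_corner (iter m nx c) b)
    (vertical_dart c b :: forward c m (~~ b) ++ [:: vertical_dart (iter m nx c) (~~ b)])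
    (forward c m b).
Proof.
have vP := is_path_vertical1 (iter m nx c) (~~ b); rewrite negbK in vP.
apply: path_homotopic_trans (path_homotopic_catr vP (annulus_homotopic c m b)) _.
rewrite -catA -[X in path_homotopic _ _ _ _ X]cats0.
apply: (path_homotopic_catl (is_path_forward _ _ _)).
have := path_homotopic_spur v (vertical_dart (iter m nx c) b).
by rewrite src_vertical_dart.
Qed.

End Homotopies.

(** The side starting at a corner c is glued to another side, which brings a second corner to the
    same vertex: [mt c], or [nx (mt c)] if flipped, and the latter differs from c by [no_spur]. Over
    each of the two corners, two squares meet at the given level. *)
Lemma corner_class_geq4 (no_spur : forall s, fl s -> nx (mt s) != s) (x : corner DS) :
  (4 <= #|[pred y | same_vertex x y]|)%N.
Proof.
set c := qcorner x; set b := level x; set c' := qsrc (qmate (c, true)).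
have cc' : qvert c c' by apply/connect1/existsP; exists (c, true); rewrite !eqxx.
have c'_neq : c' != c.
  rewrite /c' /qsrc /qmate /=; case: (boolP (fl c)) => [/no_spur|_] //=.
pose A q : corner DS := sq q (if b then o3 else o0).
pose B q : corner DS := sq (finv nx q) (if b then o2 else o1).
have E q : qvert c q -> same_vertex x (A q) /\ same_vertex x (B q).
  move=> cq; split; apply/same_vertexE; rewrite /A /B /level /qcorner ?pos_sq ?base_sq;
  by rewrite -/(level x) -/(qcorner x) -/b -/c; case: (b); rewrite /= ?f_finv.
have U : uniq [:: A c; B c; A c'; B c'].
  have F := can_eq (f_finv nxI).
  rewrite /= !inE !sq_eq !F eqxx ![c == c']eq_sym (negPf c'_neq).
  by case: (b); rewrite /= ?andbF.
rewrite -[4%N](card_uniqP U); apply/subset_leq_card/subsetP => y.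
have [? ?] := E c (connect0 _ _); have [? ?] := E c' cc'.
by rewrite !inE => /or4P[] /eqP->.
Qed.

(** With N sides there are at most N vertices, exactly 2N edges and N squares. *)
Lemma euler_double_surface (no_spur : forall s, fl s -> nx (mt s) != s) :
  (euler_char DS <= 0)%R.
Proof.
have card_sq : #|side DS| = (#|Q| * 4)%N.
  rewrite -[4%N]card_ord -card_prod; apply/esym/(@bij_eq_card _ _ (fun p => sq p.1 p.2)).
  exists (fun t => (base t, pos t)) => [[s k]|t]; first by rewrite base_sq.
  by elim/sq_ind: t => s; rewrite base_sq.
have nv : (nvertices DS * 4 <= #|Q| * 4)%N.
  rewrite -card_sq; apply: n_comp_leq (@same_vertex_sym DS) _.
  exact: corner_class_geq4.
have ne : (nedges DS * 2 = #|Q| * 4)%N.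
  by rewrite -card_sq; apply: fcard_involution; [apply: mateK|apply: mate_neq].
have np : Defs.npoly DS = #|Q| by []; rewrite /euler_char np; move: nv ne; lia.
Qed.

Lemma connected_double_surface
  (conn : forall s t, connect [rel s t | (t == nx s) || (t == mt s)] s t) :
  surface_connected DS.
Proof.
pose reach (x y : corner DS) := exists p, is_path x p y.
have reach_trans x y z : reach x y -> reach y z -> reach x z.
  by case=> p pP [q qP]; exists (p ++ q); apply: is_path_cat pP qP.
have reach_sym x y : reach x y -> reach y x.
  by case=> p pP; exists (path_rev p); apply: is_path_rev.
have reach_class x y : same_vertex x y -> reach x y by exists [::].
have to_corner x : reach x (lift_corner (qcorner x) false).
  apply: reach_trans (reach_class _ _ (src_lift_corner x)) _.
  case: (level x); last exact/reach_class/same_vertex_refl.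
  by exists [:: vertical_dart (qcorner x) true]; apply: is_path_vertical1.
suff reachQ c c' : reach (lift_corner c false) (lift_corner c' false).
  move=> x y; apply: reach_trans (to_corner x) (reach_trans _ _ _ (reachQ _ _) _).
  exact/reach_sym/to_corner.
case/connectP: (conn c c') => p; elim: p c => [|d p IHp] c /=.
  by move=> _ ->; apply/reach_class/same_vertex_refl.
case/andP=> cd dp c'E; apply: (reach_trans _ _ _ _ (IHp d dp c'E)).
have nxP e : reach (lift_corner e false) (lift_corner (nx e) false).
  by exists [:: lift_dart (e, true) false]; apply: (is_path_lift1 (e, true)).
case/orP: cd => /eqP -> //.
have : qvert c (qsrc (qmate (c, true))).
  by apply/connect1/existsP; exists (c, true); rewrite !eqxx.
move=> /(qvert_same_vertex false)/reach_class; rewrite /qsrc /qmate /=.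
by case: (fl c) => //= R; apply: reach_trans R (reach_sym _ _ (nxP _)).
Qed.


(** * Immersed labels and positions along the word *)

Section Labels.
(** [x s] is the position in [u] of the letter [lab s] read along [s]; phrasing [lab_x] with [take]
    avoids a default letter. [nondeg] says that gluing does not persist without flip from [s0] to
    the next side, as it would if faces were glued along their whole boundaries. *)
Variables (n : nat) (u : word 'I_n) (x : Q -> nat) (lab : Q -> letter 'I_n).

Definition qlab (d : Q * bool) := if d.2 then lab d.1 else inv_letter (lab d.1).

Hypotheses (x_lt : forall s, (x s < size u)%N)
  (x_nx : forall s, x (nx s) = ((x s).+1 %% size u)%N)
  (lab_x : forall s, take (x s).+1 u = rcons (take (x s) u) (lab s))
  (lab_mt : forall s, lab (mt s) = if fl s then inv_letter (lab s) else lab s)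
  (immersed : forall d d', qvert (qsrc d) (qsrc d') -> qlab d = qlab d' ->
    d' = d \/ d' = qmate d)
  (conn : forall s t, connect [rel s t | (t == nx s) || (t == mt s)] s t)
  (s0 : Q) (nondeg : ~~ fl s0 -> mt (nx s0) != nx (mt s0)).

Lemma qlab_mate d : qlab (qmate d) = qlab d.
Proof.
by case: d => s [] /=; rewrite /qlab /qmate /=; case E: (fl s);
  rewrite lab_mt E ?inv_letterK.
Qed.

Lemma qlab_rev d : qlab (qrev d) = inv_letter (qlab d).
Proof. by case: d => s []; rewrite /qlab /qrev //= inv_letterK. Qed.

Lemma x_iter s k : x (iter k nx s) = ((x s + k) %% size u)%N.
Proof.
elim: k => [|k IHk] /=; first by rewrite addn0 modn_small.
by rewrite x_nx IHk -addn1 modnDml addn1 addnS.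
Qed.

(* Two faces passing through the same vertex at the same position of u read  *)
(* the same letters forever, so they run along the same edges.  If they were  *)
(* distinct they would be glued together along their whole boundaries, and    *)
(* would be all of the surface.                                               *)
Lemma corner_inj c c' : qvert c c' -> x c = x c' -> c = c'.
Proof.
move=> cc' xcc'; apply: contrapT => c'_neq.
have lab_eq s s' : x s = x s' -> lab s = lab s'.
  move=> E; have := lab_x s; rewrite E lab_x => /(congr1 (last (lab s))).
  by rewrite !last_rcons.
have nxk_neq k : iter k nx c' <> iter k nx c.
  by elim: k => [|k IHk]; [exact: nesym|move=> /nxI].
(* By immersion, distinct sides leaving one vertex with one label are mates without flip, so their
   far ends coincide too. *)
have step s s' : qvert s s' -> x s = x s' -> s' <> s -> [/\ ~~ fl s, s' = mt s,
    qvert (nx s) (nx s') & x (nx s) = x (nx s')].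
  move=> ss' xss' neq; have E : qlab (s, true) = qlab (s', true) by apply: lab_eq.
  case: (@immersed (s, true) (s', true) ss' E) => [[] //|[Es' flE]].
  have {}flE : ~~ fl s by case: (fl s) flE.
  split=> //; last by rewrite !x_nx xss'.
  apply/connect1/existsP; exists (s, false).
  by rewrite /qsrc /qmate /= (negPf flE) Es' !eqxx.
have all_k k : [/\ qvert (iter k nx c) (iter k nx c'), x (iter k nx c) = x (iter k nx c'),
    ~~ fl (iter k nx c) & iter k nx c' = mt (iter k nx c)].
  elim: k => [|k [v_k x_k _ _]]; first by case: (step c c') => //; apply: nesym.
  have [_ _ v_k1 x_k1] := step _ _ v_k x_k (@nxk_neq k).
  by case: (step _ _ v_k1 x_k1 (@nxk_neq k.+1)).
(* The sides of the two faces are closed under [nx] and [mt], so by connectedness they include [s0],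
   where [mt] would commute with [nx]. *)
pose I t := exists k, t = iter k nx c \/ t = mt (iter k nx c).
have I_nx t : I t -> I (nx t).
  case=> k [->|->]; first by exists k.+1; left.
  have [_ _ _ <-] := all_k k; exists k.+1; right.
  by have [_ _ _ <-] := all_k k.+1.
have I_mt t : I t -> I (mt t) by case=> k [->|->]; exists k; [right|left].
have Is0 : I s0.
  case/connectP: (conn c s0) => p; have : I c by exists 0; left.
  elim: p {cc' xcc' c'_neq nxk_neq all_k} (c) => [|t p IHp] e Ie /=; first by move=> _ ->.
  by case/andP=> /orP[] /eqP->; apply: IHp; [apply: I_nx|apply: I_mt].
have [k Es0] := Is0; have [_ _ fl_k mt_k] := all_k k; have [_ _ _ mt_k1] := all_k k.+1.
have fl_s0 : ~~ fl s0 by case: Es0 => ->; rewrite ?fl_mt.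
have /eqP[] := nondeg fl_s0; case: Es0 => ->; first by rewrite -mt_k -mt_k1.
by rewrite -mt_k -[nx (iter k nx c')]/(iter k.+1 nx c') mt_k1 mtK mt_k mtK.
Qed.

Definition dart_word (p : seq (dart DS)) : word 'I_n := map (qlab \o qdart) p.

Lemma dart_word_rev p : all horizontal p ->
  dart_word (path_rev p) = inv_word (dart_word p).
Proof.
move=> hp; rewrite /dart_word /path_rev /inv_word map_rev -!map_comp; congr (rev _).
apply/eq_in_map => d /(allP hp)/lift_qdart -> /=.
by rewrite rev_lift_dart !qdart_lift qlab_rev.
Qed.

Lemma horizontal_rev p : all horizontal (path_rev p) = all horizontal p.
Proof. by rewrite /path_rev all_rev all_map. Qed.

Lemma horizontal_forward c m b : all horizontal (forward c m b).
Proof. by elim: m c => //= m IHm c; rewrite IHm andbT; exact: (horizontal_lift (c, true) b). Qed.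

Lemma level_path y p z : is_path y p z -> all horizontal p -> level z = level y.
Proof.
elim: p y => [|d p IHp] y /=; first by move=> /same_vertex_qvert[-> _].
case/andP=> /same_vertex_qvert[-> _] dp /andP[hd hp].
by rewrite (IHp _ dp hp) level_tgt_horizontal.
Qed.

Lemma qglue_sym : symmetric qglue.
Proof.
by move=> a b; apply/existsP/existsP => -[d /andP[ad bd]];
  exists (qmate d); rewrite /qmate /= mtK fl_mt addbK -surjective_pairing bd ad.
Qed.

(** A word trivial in the free group contains adjacent inverse letters, and by immersion the two
    darts reading them form a spur up to gluing. Removing it shortens the path. *)
Lemma flat_trivial v y p z : is_path y p z -> all horizontal p ->
  free_class (dart_word p) = 1 -> path_homotopic v y z p [::].
Proof.
have [k] := ubnP (size p); elim: k p => // k IHk p /ltnSE le_k pP hp p1.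
case: (eqVneq p [::]) pP => [->|p_neq0] pP; first exact: path_homotopic_refl.
have w_neq0 : dart_word p != [::] by case: (p) p_neq0.
have [u1 [l [u2 Ep]]] := trivial_word_cancels p1 w_neq0.
have [q1 [d [d' [q2 [Eq [Ed Ed']]]]]] := map_cat_cons2 Ep; rewrite /= in Ed Ed'.
have q_neq : is_path y (q1 ++ [:: d; d'] ++ q2) z by rewrite -Eq.
have [y1 q1P /is_path_catP[y2 ddP q2P]] := is_path_catP _ _ _ _ q_neq.
have /and4P[hq1 hd hd' hq2] :
    [&& all horizontal q1, horizontal d, horizontal d' & all horizontal q2].
  by rewrite Eq all_cat in hp.
have dd1 : path_homotopic v y1 y2 [:: d; d'] [::].
  move: ddP => /= /and3P[y1d dd' d'y2].
  have [lE qE] := same_vertex_qvert dd'.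
  have : d' = dart_rev d \/ d' = dart_mate (dart_rev d).
    rewrite (lift_qdart hd) (lift_qdart hd') -lE level_tgt_horizontal //.
    rewrite rev_lift_dart mate_lift_dart.
    suff [->|->]: qdart d' = qrev (qdart d) \/ qdart d' = qmate (qrev (qdart d)) by [left|right].
    apply: immersed; last by rewrite qlab_rev Ed -Ed'.
    move: qE; rewrite (lift_qdart hd) (lift_qdart hd').
    rewrite !qdart_lift => qE; apply: connect_trans (connect_trans _ qE) _.
      have [_] := same_vertex_qvert (tgt_lift_dart (qdart d) (level (dart_src d))).
      by rewrite qcorner_lift /qvert (sym_connect_sym qglue_sym).
    have [_] := same_vertex_qvert (src_lift_dart (qdart d') (level (dart_src d'))).
    by rewrite qcorner_lift.
  move=> d'E; have y1y2 : same_vertex y1 y2.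
    apply: same_vertex_trans y1d (same_vertex_trans _ d'y2).
    case: d'E => ->; first by rewrite /dart_tgt dart_revK same_vertex_refl.
    by have := dart_tgt_mate (dart_rev d); rewrite /dart_tgt dart_revK.
  apply: (path_homotopic_eqr y1y2); rewrite same_vertex_sym in y1d.
  apply: (path_homotopic_eql y1d); apply: (path_homotopic_eqr y1d).
  apply: path_homotopic_trans (path_homotopic_spur v d).
  case: d'E => ->.
    by apply/path_homotopic_refl; have [] := path_homotopic_spur v d.
  apply: (path_homotopic_catl (is_path1 d)); apply: path_homotopic_sym.
  by have := path_homotopic_mate v (dart_rev d); rewrite /dart_tgt dart_revK.
have pq : path_homotopic v y z p (q1 ++ q2).
  rewrite Eq; apply: (path_homotopic_catl q1P).
  exact: (path_homotopic_catr q2P dd1).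
apply: (path_homotopic_trans pq); apply: IHk.
- by apply: leq_trans le_k; rewrite Eq !size_cat /= ltn_add2l.
- by case: pq.
- by rewrite all_cat hq1.
rewrite -p1 Eq /dart_word !map_cat /free_class !presented_class_cat /= Ed Ed'.
congr (_ * _); rewrite -[in RHS]cat1s -[in RHS](cat1s (inv_letter l)) catA presented_class_cat.
rewrite -[LHS]mul1g; congr (_ * _).
exact/esym/presented_classP/PresCancel.
Qed.

(** * The map to the double and its injectivity *)

Section Evaluation.
Variables (w : free_group n) (psi : free_group n -> free_group n).
Hypotheses (psiM : {morph psi : g h / g * h}) (psi_inj : injective psi)
  (psi_u : forall g, cyclic_subgroup w (psi g) <-> cyclic_subgroup (free_class u) g).

Local Notation D := (double_group w).
Local Notation H := (cyclic_subgroup w).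

Definition embed (b : bool) (g : free_group n) : D := amalg_in H b (psi g).

Lemma embedM b : {morph embed b : g h / g * h}.
Proof. by move=> g h; rewrite /embed psiM amalg_inM. Qed.

Lemma embed1 b : embed b 1 = 1. Proof. exact: morph_mul1 (@embedM b). Qed.

Lemma embedV b g : embed b g^-1 = (embed b g)^-1.
Proof. exact: morph_mulV (@embedM b) g. Qed.

Lemma embed_inj b : injective (embed b).
Proof.
by move=> g h /(amalg_in_inj (cyclic_subgroup1 w) (@cyclic_subgroupM _ w)
  (@cyclic_subgroupV _ w))/psi_inj.
Qed.

Lemma embed_sub b b' g : cyclic_subgroup (free_class u) g -> embed b g = embed b' g.
Proof. by move=> /psi_u; apply: amalg_in_sub. Qed.

Definition prefix_class (c : Q) : free_group n := free_class (take (x c) u).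

Lemma prefix_class_lab c :
  prefix_class c * free_class [:: lab c] = free_class (take (x c).+1 u).
Proof. by rewrite lab_x -cats1 /free_class presented_class_cat. Qed.

(** The factor [h] is 1, except when the reading wraps round the end of [u], where it is [u]. *)
Lemma prefix_class_nx c : exists2 h, cyclic_subgroup (free_class u) h &
  prefix_class c * free_class [:: lab c] = h * prefix_class (nx c).
Proof.
rewrite prefix_class_lab /prefix_class x_nx.
have [lt_x|ge_x] := ltnP (x c).+1 (size u).
  by exists 1; rewrite ?mul1g ?modn_small //; apply: cyclic_subgroup1.
have -> : (x c).+1 = size u by apply/eqP; rewrite eqn_leq x_lt.
exists (free_class u); first by exists 1%N; left.
by rewrite modnn take0 take_size /free_class presented_class_nil mulg1.
Qed.

(** The value of the vertical edge at [c] from copy 0 to copy 1. It measures how far the two copies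
    of the prefix, which need not lie in the amalgamated subgroup, differ in the double. *)
Definition transfer (c : Q) : D :=
  (embed false (prefix_class c))^-1 * embed true (prefix_class c).

(** The relation of the square over [c]: the discrepancy [h] between the prefixes is a power of [u],
    so its two copies cancel. *)
Lemma transfer_nx c : embed false (free_class [:: lab c]) * transfer (nx c) =
  transfer c * embed true (free_class [:: lab c]).
Proof.
have [h Hh E] := prefix_class_nx c; rewrite /transfer.
have -> : free_class [:: lab c] = (prefix_class c)^-1 * (h * prefix_class (nx c)).
  by rewrite -E mulKg.
rewrite !embedM !embedV (embed_sub true false Hh).
by rewrite !mulgA !mulgK.
Qed.

Definition side_val (t : square_side) : D :=
  match val (pos t) with
  | 0 => embed false (free_class [:: lab (base t)])
  | 1 => transfer (nx (base t))
  | 2 => (embed true (free_class [:: lab (base t)]))^-1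
  | _ => (transfer (base t))^-1
  end.

Definition dart_val (d : dart DS) : D :=
  if d.2 then side_val d.1 else (side_val d.1)^-1.

Lemma side_val0 s : side_val (sq s o0) = embed false (free_class [:: lab s]).
Proof. by rewrite -[in RHS](base_sq s o0). Qed.
Lemma side_val1 s : side_val (sq s o1) = transfer (nx s).
Proof. by rewrite -[in RHS](base_sq s o1). Qed.
Lemma side_val2 s : side_val (sq s o2) = (embed true (free_class [:: lab s]))^-1.
Proof. by rewrite -[in RHS](base_sq s o2). Qed.
Lemma side_val3 s : side_val (sq s o3) = (transfer s)^-1.
Proof. by rewrite -[in RHS](base_sq s o3). Qed.
Definition side_valE := (side_val0, side_val1, side_val2, side_val3).

Lemma free_class_inv_letter (l : letter 'I_n) :
  free_class [:: inv_letter l] = (free_class [:: l])^-1.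
Proof. by rewrite /free_class -presented_class_inv. Qed.

Lemma dart_val_lift d b : dart_val (lift_dart d b) = embed b (free_class [:: qlab d]).
Proof.
case: d => s e; rewrite /dart_val /lift_dart /qlab /=.
by case: b; case: e; rewrite /= side_valE ?free_class_inv_letter ?embedV ?invgK.
Qed.

Lemma dart_val_vertical c b : dart_val (vertical_dart c b) =
  (embed b (prefix_class c))^-1 * embed (~~ b) (prefix_class c).
Proof.
rewrite /dart_val /vertical_dart /=.
by case: b; rewrite side_valE /transfer ?invgK // invgM invgK.
Qed.

Lemma dart_val_rev d : dart_val (dart_rev d) = (dart_val d)^-1.
Proof. by case: d => t []; rewrite /dart_val //= invgK. Qed.

Lemma dart_val_mate d : dart_val (dart_mate d) = dart_val d.
Proof.
have [hd|vd] := boolP (horizontal d).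
  by rewrite (lift_qdart hd) mate_lift_dart !dart_val_lift qlab_mate.
case: d vd => t b; rewrite /horizontal negbK /=; elim/sq_ind: t => s; rewrite pos_sq //= => _;
  rewrite /dart_mate /dart_val /= square_mateE ?square_flip_sq /= !side_valE;
  by case: b; rewrite /= ?f_finv ?invgK.
Qed.

Definition path_val (p : seq (dart DS)) : D := foldr (fun d g => dart_val d * g) 1 p.

Lemma path_val_cat p q : path_val (p ++ q) = path_val p * path_val q.
Proof. by elim: p => [|d p IHp] /=; rewrite ?mul1g // IHp mulgA. Qed.

Lemma path_val_move p q : elementary_move p q -> path_val p = path_val q.
Proof.
case=> [d|d|i] /=; first by rewrite dart_val_rev mulg1 mulgV.
  by rewrite dart_val_mate.
rewrite -[i](enum_valK i) poly_boundary_square /= /dart_val /= !side_valE mulg1.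
by rewrite mulgA transfer_nx mulgA mulgK mulgV.
Qed.

Lemma path_val_homotopic v (a b : loop v) : homotopic a b ->
  path_val (val a) = path_val (val b).
Proof.
elim=> // [p q r _ -> _ ->|p a' b' q a1 b1 Ea Eb /path_val_move E] //.
by rewrite Ea Eb !path_val_cat E.
Qed.

Lemma path_val_horizontal p y z : is_path y p z -> all horizontal p ->
  path_val p = embed (level y) (free_class (dart_word p)).
Proof.
elim: p y => [|d p IHp] y /=.
  by move=> _ _; rewrite /free_class presented_class_nil embed1.
case/andP=> /same_vertex_qvert[lE _] dp /andP[hd hp].
rewrite (IHp _ dp hp) level_tgt_horizontal // -lE.
rewrite -cat1s /free_class presented_class_cat embedM; congr (_ * _).
by rewrite {1}(lift_qdart hd) dart_val_lift lE.
Qed.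

Lemma path_val_flat v y p z : is_path y p z -> all horizontal p -> path_val p = 1 ->
  path_homotopic v y z p [::].
Proof.
move=> pP hp; rewrite (path_val_horizontal pP hp) -(embed1 (level y)) => /embed_inj.
exact: flat_trivial.
Qed.

(** Following a face reads [u] periodically: the quotient counts completed turns and the remainder
    is the new position. *)
Lemma prefix_class_forward c m b :
  prefix_class c * free_class (dart_word (forward c m b)) =
  free_class u ^+ ((x c + m) %/ size u) * free_class (take ((x c + m) %% size u) u).
Proof.
elim: m c => [|m IHm] c.
  by rewrite addn0 divn_small // modn_small // mul1g /free_class presented_class_nil mulg1.
rewrite /= -cat1s /free_class presented_class_cat mulgA /= qdart_lift /qlab /=.
rewrite -!/(free_class _) prefix_class_lab.
have [lt_x|ge_x] := ltnP (x c).+1 (size u).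
  have := IHm (nx c); rewrite /prefix_class x_nx modn_small // addSnnS => <-.
  by [].
have Ex : (x c).+1 = size u by apply/eqP; rewrite eqn_leq x_lt.
rewrite addnS -addSn Ex take_size divnDl // divnn modnDl.
have -> : (0 < size u)%N by rewrite -Ex.
rewrite expgnDr expg1 -mulgA; congr (_ * _).
have := IHm (nx c); rewrite /prefix_class x_nx Ex modnn take0 /free_class presented_class_nil mul1g.
exact.
Qed.

(** [m] is chosen so that the path along the face reads the same element as [p]; the two differ by a
    flat loop with trivial label. They thus end at one vertex and one position of [u], and
    [corner_inj] identifies the final corners. *)
Lemma homotopic_forward v c1 c2 b p j :
  is_path (lift_corner c1 b) p (lift_corner c2 b) -> all horizontal p ->
  prefix_class c1 * free_class (dart_word p) * (prefix_class c2)^-1 = free_class u ^+ j ->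
  (x c1 <= j * size u + x c2)%N ->
  let m := (j * size u + x c2 - x c1)%N in
  iter m nx c1 = c2 /\
  path_homotopic v (lift_corner c1 b) (lift_corner c2 b) p (forward c1 m b).
Proof.
move=> pP hp E le_x m; have fP := is_path_forward c1 m b.
have hf := horizontal_forward c1 m b.
have Em : (x c1 + m = j * size u + x c2)%N by rewrite subnKC.
have u_gt0 : (0 < size u)%N by apply: leq_ltn_trans (x_lt c1).
have fE : free_class (dart_word (path_rev (forward c1 m b) ++ p)) = 1.
  rewrite /dart_word map_cat /free_class presented_class_cat -!/(dart_word _).
  rewrite dart_word_rev // presented_class_inv -!/(free_class _).
  suff -> : free_class (dart_word (forward c1 m b)) = free_class (dart_word p) by rewrite mulVg.
  apply: (@mulgI _ (prefix_class c1)); rewrite prefix_class_forward Em.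
  rewrite divnMDl // modnMDl divn_small // addn0 modn_small // -E.
  by rewrite mulgVK.
have hfp : all horizontal (path_rev (forward c1 m b) ++ p).
  by rewrite all_cat horizontal_rev hf.
have rfP := is_path_cat (is_path_rev fP) pP.
have fp1 := flat_trivial v rfP hfp fE.
have mE : iter m nx c1 = c2.
  have [_ /same_vertex_qvert[_]] := fp1; rewrite !qcorner_lift => cc' _.
  by apply: corner_inj cc' _; rewrite x_iter Em modnMDl modn_small.
split=> //; rewrite mE in fP fp1; exact: path_homotopic_divg fp1.
Qed.

(** The syllable that [p] contributes between two vertical darts lies in the amalgamated subgroup,
    so it can be moved to the other factor. *)
Definition cyclic_link (d1 : dart DS) (p : seq (dart DS)) (d2 : dart DS) : Prop :=
  cyclic_subgroup (free_class u)
    (prefix_class (qcorner (dart_src d1)) * free_class (dart_word p) *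
     (prefix_class (qcorner (dart_src d2)))^-1).

(** Replace [p] by a path along the face and push it across the annulus to the other level. *)
Lemma homotopic_bulge v c1 c2 b p :
  is_path (lift_corner c1 (~~ b)) p (lift_corner c2 (~~ b)) -> all horizontal p ->
  cyclic_subgroup (free_class u)
    (prefix_class c1 * free_class (dart_word p) * (prefix_class c2)^-1) ->
  exists2 q, all horizontal q &
    path_homotopic v (lift_corner c1 b) (lift_corner c2 b)
      (vertical_dart c1 b :: p ++ [:: vertical_dart c2 (~~ b)]) q.
Proof.
wlog: c1 c2 p / exists2 j, prefix_class c1 * free_class (dart_word p) * (prefix_class c2)^-1 =
    free_class u ^+ j & (x c1 <= j * size u + x c2)%N.
  move=> WL pP hp H12; have [j E] := H12.
  have hrp : all horizontal (path_rev p) by rewrite horizontal_rev.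
  have H21 : prefix_class c2 * free_class (dart_word (path_rev p)) * (prefix_class c1)^-1 =
      (prefix_class c1 * free_class (dart_word p) * (prefix_class c2)^-1)^-1.
    by rewrite dart_word_rev // /free_class presented_class_inv !invgM invgK mulgA.
  have rev_case : (exists2 j, prefix_class c2 * free_class (dart_word (path_rev p)) *
      (prefix_class c1)^-1 = free_class u ^+ j & (x c2 <= j * size u + x c1)%N) ->
      exists2 q, all horizontal q & path_homotopic v (lift_corner c1 b) (lift_corner c2 b)
        (vertical_dart c1 b :: p ++ [:: vertical_dart c2 (~~ b)]) q.
    move=> ex_j; have := WL c2 c1 (path_rev p) ex_j (is_path_rev pP) hrp.
    case; first by rewrite H21; apply: cyclic_subgroupV.
    move=> q hq pq; exists (path_rev q); first by rewrite horizontal_rev.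
    have := path_homotopic_rev pq; congr path_homotopic.
    rewrite -cat1s path_rev_cat path_rev_cat path_revK -catA cat1s.
    by rewrite /path_rev /= !rev_vertical_dart negbK.
  (* Either [p] or its reverse runs forward along the face. Positions are smaller than the size of
     [u], so when the sign of the exponent and the order of positions disagree, [j] is 0 and the
     positions decide. *)
  have [le12|/ltnW le21] := leqP (x c1) (j * size u + x c2)%N.
    case: E => E; first by apply: WL => //; exists j.
    have [le21|lt12] := leqP (x c2) (j * size u + x c1)%N.
      by apply: rev_case; exists j; rewrite // H21 E invgK.
    suff j0 : j = 0%N by apply: WL => //; exists 0%N; [rewrite E j0 invg1|rewrite j0 in le12].
    move: (leq_trans lt12 (ltnW (x_lt c2))) => {}lt12.
    by case: j {E le12} lt12 => //= j; rewrite mulSn -addnA ltnNge leq_addr.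
  case: E => E; last by apply: rev_case; exists j;
    rewrite ?H21 ?E ?invgK //; apply: leq_trans (leq_trans (leq_addl _ _) le21) (leq_addl _ _).
  have j0 : j = 0%N.
    have := leq_ltn_trans le21 (x_lt c1).
    by case: j {E le21} => //= j; rewrite mulSn -addnA ltnNge leq_addr.
  apply: rev_case; exists 0%N; first by rewrite H21 E j0 invg1.
  by apply: leq_trans le21; rewrite leq_addl.
case=> j E le_x pP hp _.
have [] := homotopic_forward v pP hp E le_x; set m := (_ - _)%N => <- pq.
exists (forward c1 m b); first exact: horizontal_forward.
apply: path_homotopic_trans (bulge_homotopic _ _ _ _).
apply: (path_homotopic_catl (is_path_vertical1 c1 b)).
apply: path_homotopic_catr pq.
by have := is_path_vertical1 (iter m nx c1) (~~ b); rewrite negbK.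
Qed.

(** The induction step for loops: two vertical darts disappear and only level darts are added. *)
Lemma homotopic_remove v y p1 d1 p d2 p2 z :
  is_path y (p1 ++ [:: d1] ++ p ++ [:: d2] ++ p2) z ->
  ~~ horizontal d1 -> all horizontal p -> ~~ horizontal d2 -> cyclic_link d1 p d2 ->
  exists2 q, all horizontal q &
    path_homotopic v y z (p1 ++ [:: d1] ++ p ++ [:: d2] ++ p2) (p1 ++ q ++ p2).
Proof.
move=> P vd1 hp vd2 link.
have [y1 p1P /is_path_catP[y2 d1P /is_path_catP[y3 pP]]] := is_path_catP _ _ _ _ P.
case/is_path_catP=> y4 d2P p2P.
pose b := level (dart_src d1).
pose c1 := qcorner (dart_src d1); pose c2 := qcorner (dart_src d2).
move: d1P => /= /andP[y1d1 d1y2]; move: d2P => /= /andP[y3d2 d2y4].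
have src1 : same_vertex (dart_src d1) (lift_corner c1 b) by apply: src_lift_corner.
have tgt1 : same_vertex (dart_tgt d1) (lift_corner c1 (~~ b)).
  by have := src_lift_corner (dart_tgt d1); rewrite qcorner_tgt_vertical // level_tgt_vertical.
have y2E : same_vertex y2 (lift_corner c1 (~~ b)).
  by apply: same_vertex_trans tgt1; rewrite same_vertex_sym.
have lev2 : level (dart_src d2) = ~~ b.
  have [<- _] := same_vertex_qvert y3d2; rewrite (level_path pP hp).
  by have [-> _] := same_vertex_qvert y2E; rewrite level_lift.
have src2 : same_vertex (dart_src d2) (lift_corner c2 (~~ b)).
  by have := src_lift_corner (dart_src d2); rewrite lev2.
have tgt2 : same_vertex (dart_tgt d2) (lift_corner c2 b).
  have := src_lift_corner (dart_tgt d2).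
  by rewrite qcorner_tgt_vertical // level_tgt_vertical // lev2 negbK.
have y3E := same_vertex_trans y3d2 src2.
have pP' : is_path (lift_corner c1 (~~ b)) p (lift_corner c2 (~~ b)).
  by rewrite -(is_path_eql _ _ y2E) -(is_path_eqr _ _ y3E).
have [q hq pq] := homotopic_bulge v pP' hp link; exists q => //.
suff pq' : path_homotopic v y1 y4 (d1 :: p ++ [:: d2]) q.
  have -> : p1 ++ [:: d1] ++ p ++ [:: d2] ++ p2 = p1 ++ (d1 :: p ++ [:: d2]) ++ p2.
    by rewrite /= -catA.
  exact: path_homotopic_catl p1P (path_homotopic_catr p2P pq').
have y1E := same_vertex_trans y1d1 src1.
have y4E : same_vertex y4 (lift_corner c2 b).
  by apply: same_vertex_trans tgt2; rewrite same_vertex_sym.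
rewrite same_vertex_sym in y1E; rewrite same_vertex_sym in y4E.
apply: (path_homotopic_eql y1E); apply: (path_homotopic_eqr y4E).
apply: path_homotopic_trans pq; rewrite -cat1s -[X in path_homotopic _ _ _ _ X]cat1s.
have v1 := vertical_homotopic v vd1; have v2 := vertical_homotopic v vd2.
rewrite -/b -/c1 in v1; rewrite lev2 -/c2 in v2.
apply: path_homotopic_cat (path_homotopic_eql src1 (path_homotopic_eqr tgt1 v1)) _.
apply: path_homotopic_catl pP' _.
exact: path_homotopic_eql src2 (path_homotopic_eqr tgt2 v2).
Qed.

Local Notation dact := (@double_act _ H (cyclic_subgroup1 w)).
Local Notation st1 := (state1 (free_group n)).

Let H1 := cyclic_subgroup1 w.
Let HM := @cyclic_subgroupM _ w.
Let HV := @cyclic_subgroupV _ w.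

Definition reducible (p : seq (dart DS)) : Prop :=
  exists p1 d1 p' d2 p2, [/\ p = p1 ++ [:: d1] ++ p' ++ [:: d2] ++ p2,
    ~~ horizontal d1, all horizontal p', ~~ horizontal d2 & cyclic_link d1 p' d2].

Lemma dart_val_vertical_dart d : ~~ horizontal d ->
  let b := level (dart_src d) in let g := prefix_class (qcorner (dart_src d)) in
  embed b g * dart_val d = embed (~~ b) g.
Proof.
move=> vd b g; have -> : dart_val d = dart_val (vertical_dart (qcorner (dart_src d)) b).
  by case: (vertical_dartE vd) => <-; rewrite ?dart_val_mate.
by rewrite dart_val_vertical mulVKg.
Qed.

Lemma starts_neg b (l : seq (bool * free_group n)) : starts b l -> ~~ starts (~~ b) l.
Proof. by case: l => [|[b' t] l] //= /eqP ->; case: b. Qed.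

(* A vertical dart d at a corner c on level b contributes                     *)
(* P(c)_b^-1 P(c)_(~~b); the first factor is cancelled here so that the value *)
(* splits into alternating factors, one for each horizontal stretch.          *)
Lemma irreducible_normal_form y d p z : ~ reducible (d :: p) ->
  is_path y (d :: p) z -> ~~ horizontal d ->
  let b := level (dart_src d) in
  let st := dact (embed b (prefix_class (qcorner (dart_src d))) * path_val (d :: p)) st1 in
  ~~ starts b st.2 /\ (~~ all horizontal p -> starts (~~ b) st.2).
Proof.
have [k] := ubnP (size p); elim: k y d p => // k IHk y d p /ltnSE le_k irr P vd b st.
have v1 := @state1_valid _ _ H1.
move: P => /= /andP[yd pP].
have levd := level_tgt_vertical vd; rewrite -/b in levd.
have [hp|nhp] := boolP (all horizontal p).
  split=> //; have -> : st = amalg_act H1 (~~ b) (psi (prefix_class (qcorner (dart_src d)) *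
      free_class (dart_word p))) st1.
    rewrite -double_act_in // -/(embed _ _) embedM /st /= mulgA dart_val_vertical_dart //.
    by rewrite (path_val_horizontal pP hp) levd.
  by have := @amalg_act_state1 _ _ H1 (~~ b); rewrite negbK; apply.
suff E : starts (~~ b) st.2 by split=> //; have := starts_neg E; rewrite negbK.
move: nhp; rewrite -has_predC => nhp.
case/split_find: nhp pP irr le_k @st => d2 p' p2 /= vd2; rewrite -all_predC => hp' pP irr le_k.
have {}hp' : all horizontal p' by apply: sub_all hp' => e /=; rewrite negbK.
move: pP irr le_k; rewrite cat_rcons => /is_path_catP[y2 p'P dp2P] irr le_k.
have lev2 : level (dart_src d2) = ~~ b.
  have /andP[/same_vertex_qvert[<- _] _] := dp2P.
  by rewrite (level_path p'P hp') levd.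
pose g := prefix_class (qcorner (dart_src d)) * free_class (dart_word p') *
     (prefix_class (qcorner (dart_src d2)))^-1.
(* [g] is the syllable of the first level stretch; were it in the subgroup, the path would be
   reducible. *)
have nHg : ~ H (psi g).
  move=> /psi_u Hg; apply: irr; exists [::], d, p', d2, p2; split=> //.
have irr2 : ~ reducible (d2 :: p2).
  case=> q1 [e1 [q [e2 [q2 [E ? ? ? ?]]]]]; apply: irr.
  by exists (d :: p' ++ q1), e1, q, e2, q2; split=> //; rewrite E /= -catA.
have sz2 : (size p2 < k)%N.
  by apply: leq_trans le_k; rewrite size_cat /= addnS ltnS leq_addl.
have [ns _] := IHk _ _ _ sz2 irr2 dp2P vd2; rewrite lev2 in ns.
have -> : dact (embed b (prefix_class (qcorner (dart_src d))) *
      (dart_val d * path_val (p' ++ d2 :: p2))) st1 = amalg_act H1 (~~ b) (psi g)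
    (dact (embed (~~ b) (prefix_class (qcorner (dart_src d2))) * path_val (d2 :: p2)) st1).
  rewrite -double_act_in //; last exact: double_act_valid.
  rewrite -double_actM // -/(embed _ _); congr (dact _ _).
  rewrite path_val_cat !mulgA dart_val_vertical_dart //.
  rewrite (path_val_horizontal p'P hp') levd -/b /g !embedM embedV.
  by rewrite mulgVK.
by apply: amalg_act_starts => //; apply: double_act_valid.
Qed.

Lemma path_val_trivial v p : is_path v p v -> path_val p = 1 -> path_homotopic v v v p [::].
Proof.
have v1 := @state1_valid _ _ H1.
have [k] := ubnP (count (predC horizontal) p); elim: k p => // k IHk p /ltnSE le_k pP p1.
have [hp|nhp] := boolP (all horizontal p); first exact: path_val_flat pP hp p1.
have [[q1 [d1 [q [d2 [q2 [E vd1 hq vd2 link]]]]]]|irr] := pselect (reducible p).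
  rewrite E in pP; have [q' hq' pq] := homotopic_remove v pP vd1 hq vd2 link.
  rewrite -E in pP pq; apply: (path_homotopic_trans pq); have [_ q'P _] := pq.
  have q'1 : path_val (q1 ++ q' ++ q2) = 1.
    rewrite -p1; pose a : loop v := exist (fun p => is_path v p v) _ pP.
    pose a' : loop v := exist (fun p => is_path v p v) _ q'P.
    apply: (@path_val_homotopic v a' a); apply: path_homotopic_loop.
    exact: path_homotopic_sym.
  apply: IHk => //; apply: leq_trans le_k.
  rewrite E !count_cat /= vd1 vd2.
  have -> : count (predC horizontal) q' = 0%N.
    by apply/eqP; rewrite -leqn0 leqNgt -has_count has_predC hq'.
  lia.
exfalso; move: nhp; rewrite -has_predC => nhp.
case/split_find: nhp pP irr p1 {le_k} => d p' p2 /= vd; rewrite -all_predC => hp'.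
have {}hp' : all horizontal p' by apply: sub_all hp' => e /=; rewrite negbK.
rewrite cat_rcons => /is_path_catP[y p'P dpP] irr.
have lev : level (dart_src d) = level v.
  have /andP[/same_vertex_qvert[<- _] _] := dpP.
  by rewrite (level_path p'P hp').
have irr2 : ~ reducible (d :: p2).
  case=> q1 [e1 [q [e2 [q2 [E ? ? ? ?]]]]]; apply: irr.
  by exists (p' ++ q1), e1, q, e2, q2; split=> //; rewrite E /= -catA.
have [_] := irreducible_normal_form irr2 dpP vd; rewrite lev.
(* A vertical dart changes the level and a loop returns to its own, so a second vertical dart must
   follow. *)
have nhp2 : ~~ all horizontal p2.
  apply/negP => hp2; have /andP[_ p2P] := dpP.
  have := level_path p2P hp2; rewrite level_tgt_vertical // lev.
  by case: (level v).
move=> /(_ nhp2) st p1; have /(congr1 (dact^~ st1)) := p1.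
rewrite double_act1 // path_val_cat (path_val_horizontal p'P hp').
(* Inserting the prefix and its inverse completes the first syllable, which lies in the factor
   opposite to the one where the remaining normal form starts. *)
rewrite -[X in _ * X](mulKg (embed (level v) (prefix_class (qcorner (dart_src d))))).
rewrite mulgA -embedV -embedM double_actM // double_act_in //; last exact: double_act_valid.
exact: amalg_act_neq1.
Qed.

Definition double_map (v : corner DS) (g : fundamental_group v) : D :=
  path_val (val (repr (g : {eq_quot pg_equiv (loop_pregroup v)}))).

Lemma double_map_class v (a : loop v) :
  double_map (@pg_class (loop_pregroup v) a) = path_val (val a).
Proof. exact/path_val_homotopic/(@pg_class_repr (loop_pregroup v)). Qed.

Lemma double_mapM v : {morph @double_map v : g h / g * h}.
Proof.
move=> g h; have [a <-] := pg_class_surj g; have [b <-] := pg_class_surj h.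
by rewrite pg_class_mul !double_map_class path_val_cat.
Qed.

Lemma double_map_inj v : injective (@double_map v).
Proof.
apply: (morph_mul_inj (@double_mapM v)) => g; have [a <-] := pg_class_surj g.
rewrite double_map_class pg_class_one => a1.
apply/pg_classP; apply: path_homotopic_loop; exact: path_val_trivial (valP a) a1.
Qed.

HB.instance Definition _ v := isMultiplicative.Build (fundamental_group v) D
  (@double_map v) (@double_mapM v).

Lemma contains_surface_group_double (no_spur : forall s, fl s -> nx (mt s) != s) :
  contains_surface_group D.
Proof.
exists DS, (lift_corner s0 false); split.
- exact: connected_double_surface.
- exact: euler_double_surface.
- by exists (@double_map _); apply: double_map_inj.
Qed.

End Evaluation.
End Labels.
End Pairing.

(** * Connected components and periodic words *)

(** On a finite set an injective [f] has cyclic orbits, so a step by [f] is undone by further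
    steps. *)
Lemma connect_next_mate_sym (P : finType) (f g : P -> P) : injective f -> involutive g ->
  connect_sym [rel s t | (t == f s) || (t == g s)].
Proof.
move=> fI gK; set e : rel P := [rel s t | _].
have step s t : e s t -> connect e t s.
  case/orP=> /eqP ->; last by apply: connect1; rewrite /e /= gK eqxx orbT.
  have : fconnect f (f s) s by rewrite fconnect_sym // fconnect1.
  by apply: connect_sub => a b /= /eqP <-; apply: connect1; rewrite /e /= eqxx.
suff H s t : connect e s t -> connect e t s by move=> s t; apply/idP/idP; apply: H.
case/connectP=> p; elim: p s => [|a p IHp] s /=; first by move=> _ ->; apply: connect0.
by case/andP=> /step sa ap tE; apply: connect_trans (IHp _ ap tE) sa.
Qed.

Section Component.
Variables (Q : finType) (nx mt : Q -> Q) (fl : Q -> bool).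
Hypotheses (nxI : injective nx) (mtK : involutive mt)
  (mt_neq : forall s, mt s != s) (fl_mt : forall s, fl (mt s) = fl s).
Variables (n : nat) (u : word 'I_n) (x : Q -> nat) (lab : Q -> letter 'I_n).
Hypotheses (x_lt : forall s, (x s < size u)%N)
  (x_nx : forall s, x (nx s) = ((x s).+1 %% size u)%N)
  (lab_x : forall s, take (x s).+1 u = rcons (take (x s) u) (lab s))
  (lab_mt : forall s, lab (mt s) = if fl s then inv_letter (lab s) else lab s)
  (immersed : forall d d', qvert nx mt fl (qsrc nx d) (qsrc nx d') ->
    qlab lab d = qlab lab d' -> d' = d \/ d' = qmate mt fl d)
  (no_spur : forall s, fl s -> nx (mt s) != s)
  (s0 : Q) (nondeg : ~~ fl s0 -> mt (nx s0) != nx (mt s0)).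

Let adj (f g : Q -> Q) : rel Q := [rel s t | (t == f s) || (t == g s)].

Let C : finType := {t : Q | connect (adj nx mt) s0 t}.

Fact component_next (t : C) : connect (adj nx mt) s0 (nx (val t)).
Proof. by apply: connect_trans (valP t) (connect1 _); rewrite /adj /= eqxx. Qed.

Fact component_mate (t : C) : connect (adj nx mt) s0 (mt (val t)).
Proof. by apply: connect_trans (valP t) (connect1 _); rewrite /adj /= eqxx orbT. Qed.

Let nxC (t : C) : C := Sub (nx (val t)) (component_next t).
Let mtC (t : C) : C := Sub (mt (val t)) (component_mate t).

(** The double must be connected, so everything is restricted to the component of [s0]; vertices of
    the component are contained in vertices of the whole, which preserves the immersion
    hypothesis. *)
Lemma contains_surface_group_component (w : free_group n) (psi : free_group n -> free_group n) :
  {morph psi : g h / g * h} -> injective psi ->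
  (forall g, cyclic_subgroup w (psi g) <-> cyclic_subgroup (free_class u) g) ->
  contains_surface_group (double_group w).
Proof.
move=> psiM psi_inj psi_u.
have nxCI : injective nxC by move=> s t /(congr1 val)/nxI/val_inj.
have mtCK : involutive mtC by move=> s; apply: val_inj; rewrite /= mtK.
have mtC_neq s : mtC s != s by rewrite -val_eqE mt_neq.
have flC_mt s : (fl \o val) (mtC s) = (fl \o val) s by rewrite /= fl_mt.
have qvertC s t : qvert nxC mtC (fl \o val) s t -> qvert nx mt fl (val s) (val t).
  case/connectP=> p; elim: p s => [|a p IHp] s /=; first by move=> _ ->; apply: connect0.
  case/andP=> /existsP[[d b] /andP[/eqP-> /eqP Ea]] ap tE.
  apply: connect_trans (connect1 _) (IHp _ ap tE).
  apply/existsP; exists (val d, b); rewrite Ea /qsrc /qmate /=.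
  by case: (b); case: (fl _); rewrite !eqxx.
have srcC d : val (qsrc nxC d) = qsrc nx (val d.1, d.2) by case: d => s [].
have immersedC d d' : qvert nxC mtC (fl \o val) (qsrc nxC d) (qsrc nxC d') ->
    qlab (lab \o val) d = qlab (lab \o val) d' -> d' = d \/ d' = qmate mtC (fl \o val) d.
  move=> /qvertC; rewrite !srcC => /immersed E /E [] [E1 E2]; [left|right].
    by case: d d' E1 E2 {E} => [s b] [s' b'] /= /val_inj -> ->.
  by case: d d' E1 E2 {E} => [s b] [s' b'] /= E1 ->; congr pair; apply: val_inj.
have symC := connect_next_mate_sym nxCI mtCK.
have connC s t : connect [rel s t | (t == nxC s) || (t == mtC s)] s t.
  set e := (X in connect X).
  have from0 (r : C) : connect e (Sub s0 (connect0 _ _)) r.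
    case: r => r /= Hr; have /connectP[p] := Hr.
    elim/last_ind: p r Hr => [|p a IHp] r Hr /=.
      by move=> _ Er; rewrite (_ : Sub s0 _ = exist _ r Hr) ?connect0 //; apply: val_inj.
    rewrite rcons_path last_rcons => /andP[pP pa] Er.
    have Hl : connect (adj nx mt) s0 (last s0 p) by apply/connectP; exists p.
    apply: connect_trans (IHp _ Hl pP erefl) (connect1 _).
    by rewrite /e /= -[X in X || _]val_eqE -[X in _ || X]val_eqE /= Er.
  by apply: connect_trans (from0 t); rewrite symC.
apply: (contains_surface_group_double nxCI mtCK mtC_neq flC_mt (u := u) (x := x \o val)
  (lab := lab \o val) _ _ _ _ immersedC connC (s0 := Sub s0 (connect0 _ _)) _ psiM psi_inj psi_u).
- by move=> s; apply: x_lt.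
- by move=> s; apply: x_nx.
- by move=> s; apply: lab_x.
- by move=> s; apply: lab_mt.
- by rewrite /= -val_eqE.
- by move=> s /= fs; rewrite -val_eqE /= no_spur.
Qed.

End Component.

(** * Positions in powers of a word *)

Section PeriodicWords.
Variable T : Type.

Lemma nth_rot (d : T) s r i : (r <= size s)%N -> (i < size s)%N ->
  nth d (rot r s) i = nth d s ((i + r) %% size s).
Proof.
move=> le_r lt_i; rewrite /rot nth_cat size_drop nth_drop.
have [lt_ir|ge_ir] := ltnP i (size s - r); first by rewrite addnC modn_small //; lia.
have -> : ((i + r) %% size s = i - (size s - r))%N.
  have -> : (i + r = size s + (i - (size s - r)))%N by lia.
  by rewrite modnDl modn_small //; lia.
by rewrite nth_take //; lia.
Qed.

Lemma nth_flatten_nseq (d : T) s k i : (i < k * size s)%N ->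
  nth d (flatten (nseq k s)) i = nth d s (i %% size s).
Proof.
elim: k i => [|k IHk] i //= lt_i; rewrite nth_cat.
have [lt_is|ge_is] := ltnP i (size s); first by rewrite modn_small.
rewrite IHk; last by move: lt_i; rewrite mulSn; lia.
by rewrite -[in RHS](subnKC ge_is) modnDl.
Qed.

Lemma size_flatten_nseq (s : seq T) k : size (flatten (nseq k s)) = (k * size s)%N.
Proof. by elim: k => //= k IHk; rewrite size_cat IHk mulSn. Qed.

Lemma cycle_nth (d : T) (e : rel T) s i : cycle e s -> (i < size s)%N ->
  e (nth d s i) (nth d s (i.+1 %% size s)).
Proof.
case: s => //= a s /(pathP d) es; rewrite ltnS => le_i.
have := es i; rewrite size_rcons ltnS => /(_ le_i).
rewrite -rcons_cons nth_rcons /= ltnS le_i nth_rcons.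
move: le_i; rewrite leq_eqVlt => /orP[/eqP->|lt_i]; first by rewrite ltnn eqxx modnn.
by rewrite lt_i modn_small.
Qed.

End PeriodicWords.

Section ReadingPowers.
Variable n : nat.
Implicit Types (u b : word 'I_n).

Lemma inv_word_cat u b : inv_word (u ++ b) = inv_word b ++ inv_word u.
Proof. by rewrite /inv_word map_cat rev_cat. Qed.

Lemma size_inv_word u : size (inv_word u) = size u.
Proof. by rewrite /inv_word size_rev size_map. Qed.

Lemma inv_word_flatten u k : flatten (nseq k (inv_word u)) = inv_word (flatten (nseq k u)).
Proof.
elim: k => //= k IHk; rewrite inv_word_cat -IHk.
by elim: k {IHk} => [|k IHk] /=; rewrite ?cats0 // -catA -IHk.
Qed.

Lemma inv_word_rotr u r : inv_word (rotr r u) = rot r (inv_word u).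
Proof. by rewrite /inv_word map_rotr rev_rotr. Qed.

(** The sign of the exponent is absorbed into the reading direction. *)
Lemma reads_powerP b u : reads_power b u ->
  exists (dir : bool) r k, (if dir then b else inv_word b) = rot r (flatten (nseq k u)).
Proof.
case=> r [dir [[k|k] [_ E]]].
  exists dir, (size (flatten (nseq k u)) - r)%N, k.
  by rewrite -[rot _ _]/(rotr r _) -[flatten _]/(pow_word u k) -E rotK.
exists (~~ dir), r, k.+1; have {}E :
    (if dir then b else inv_word b) = rotr r (inv_word (flatten (nseq k.+1 u))).
  by rewrite -inv_word_flatten -[flatten _]/(pow_word u (Negz k)) -E rotK.
have := congr1 (@inv_word _) E; rewrite inv_word_rotr inv_wordK => <-.
by case: dir {E}; rewrite ?inv_wordK.
Qed.

(** Gives each side of a face its position in [u]; when the face reads [u] backwards, the position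
    advances on passing to the preceding side. *)
Lemma reads_power_position (l0 : letter 'I_n) b u : (0 < size b)%N -> reads_power b u ->
  exists (dir : bool) (p : nat -> nat), forall j, (j < size b)%N ->
  [/\ (p j < size u)%N,
      nth l0 u (p j) = if dir then nth l0 b j else inv_letter (nth l0 b j) &
      p (if dir then j.+1 %% size b else (j + size b).-1 %% size b)%N = ((p j).+1 %% size u)%N].
Proof.
move=> b_gt0 /reads_powerP[dir [r [k E]]].
have {r E} [r [le_r E]] : exists r, (r <= size (flatten (nseq k u)))%N /\
    (if dir then b else inv_word b) = rot r (flatten (nseq k u)).
  have [le_r|/ltnW ge_r] := leqP r (size (flatten (nseq k u))); first by exists r.
  by exists 0%N; rewrite E rot_oversize // rot0.
have sz : size b = (k * size u)%N.
  have := congr1 size E; rewrite size_rot size_flatten_nseq => <-.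
  by case: (dir); rewrite ?size_inv_word.
have u_gt0 : (0 < size u)%N by move: b_gt0; rewrite sz muln_gt0 => /andP[].
have dvd : (size u %| size b)%N by rewrite sz dvdn_mull.
have nthE i : (i < size b)%N ->
    nth l0 (if dir then b else inv_word b) i = nth l0 u ((i + r) %% size u).
  move=> lt_i; rewrite E nth_rot ?size_flatten_nseq -?sz //; last by rewrite sz -size_flatten_nseq.
  by rewrite nth_flatten_nseq -?sz ?ltn_mod // modn_dvdm.
case: dir E nthE => E nthE.
  exists true, (fun j => (j + r) %% size u)%N => j lt_j; split; first by rewrite ltn_mod.
    by rewrite -nthE.
  by rewrite -modnDml modn_dvdm // modnDml -[in RHS]addn1 modnDml addn1 addSn.
(* Letter [j] of [b] is, inverted, letter [size b - j.+1] of the inverse word. *)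
exists false, (fun j => (size b - j.+1 + r) %% size u)%N => j lt_j.
split; first by rewrite ltn_mod.
  rewrite -nthE; last by lia.
  rewrite /inv_word nth_rev size_map; last by lia.
  rewrite (nth_map l0); last by lia.
  by congr (inv_letter (nth _ _ _)); lia.
rewrite -[in RHS]addn1 modnDml.
case: j lt_j => [|j] lt_j.
  rewrite add0n [((size b).-1 %% _)%N]modn_small; last by lia.
  have -> : (size b - (size b).-1.+1 + r = r)%N by lia.
  have -> : (size b - 1 + r + 1 = size b + r)%N by lia.
  by rewrite -modnDml (eqP dvd) add0n.
rewrite addSn /= modnDr [(j %% _)%N]modn_small; last by lia.
by congr (_ %% _)%N; lia.
Qed.

End ReadingPowers.

(** * Reorienting the faces of a polygonal surface *)

Section PolygonalSurface.
Variables (S : surface) (n : nat) (phi : side S -> letter 'I_n) (u : word 'I_n).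
Hypotheses (graph_map : is_graph_map phi) (imm : is_immersion phi).
Variables (dir : 'I_(Defs.npoly S) -> bool) (posn : 'I_(Defs.npoly S) -> nat -> nat).
Variable l0 : letter 'I_n.
Hypothesis posnP : forall i j, (j < size (boundary_word phi i))%N ->
  let b := boundary_word phi i in
  [/\ (posn i j < size u)%N,
      nth l0 u (posn i j) = if dir i then nth l0 b j else inv_letter (nth l0 b j) &
      posn i (if dir i then j.+1 %% size b else (j + size b).-1 %% size b)%N =
        ((posn i j).+1 %% size u)%N].

(* The faces are reoriented so that each of them reads u forwards. *)
Let dirs (s : side S) := dir (tag s).
Let prev_side (s : side S) : side S := mk_side (ord_pred (tagged s)).
Let nx (s : side S) : side S := if dirs s then next_side s else prev_side s.
Let mt : side S -> side S := @mate S.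
(** Reversing either of the two faces along an edge toggles the flip. *)
Let fl (s : side S) := flip s (+) ~~ dirs s (+) ~~ dirs (mt s).
Let x (s : side S) : nat := posn (tag s) (tagged s).
Let lab (s : side S) := if dirs s then phi s else inv_letter (phi s).
(** A reversed side starts at its former end, so a side names different corners before and after
    reorientation; [corner_of] and [side_of] translate. *)
Let corner_of (s : side S) : corner S := if dirs s then s else next_side s.
Let side_of (c : corner S) : side S := if dirs c then c else prev_side c.
Let dart_of (d : side S * bool) : dart S := (d.1, d.2 (+) ~~ dirs d.1).

Lemma next_sideK : cancel (@next_side S) prev_side.
Proof. by case=> i j; rewrite /prev_side /next_side /mk_side /= ordSK. Qed.

Lemma prev_sideK : cancel prev_side (@next_side S).
Proof. by case=> i j; rewrite /prev_side /next_side /mk_side /= ord_predK. Qed.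

Lemma dirs_next s : dirs (next_side s) = dirs s. Proof. by []. Qed.
Lemma dirs_prev s : dirs (prev_side s) = dirs s. Proof. by []. Qed.

Lemma dirs_nx s : dirs (nx s) = dirs s.
Proof. by rewrite /nx; case: ifP. Qed.

Lemma oriented_next_inj : injective nx.
Proof.
apply: (@can_inj _ _ _ (fun s => if dirs s then prev_side s else next_side s)) => s.
by rewrite dirs_nx /nx; case: (dirs s); rewrite ?next_sideK ?prev_sideK.
Qed.

Lemma corner_ofK : cancel corner_of side_of.
Proof.
by move=> s; rewrite /side_of /corner_of; case E: (dirs s); rewrite ?dirs_next E ?next_sideK.
Qed.

Lemma side_ofK : cancel side_of corner_of.
Proof.
by move=> s; rewrite /side_of /corner_of; case E: (dirs s); rewrite ?dirs_prev E ?prev_sideK.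
Qed.

Lemma oriented_flip_mate s : fl (mt s) = fl s.
Proof. by rewrite /fl /mt mateK flip_mate addbAC. Qed.

Lemma dart_ofK : involutive dart_of.
Proof. by case=> s b; rewrite /dart_of /= addbK. Qed.

Lemma dart_of_mate d : dart_of (qmate mt fl d) = dart_mate (dart_of d).
Proof.
case: d => s b; rewrite /dart_of /qmate /dart_mate /fl /=; congr pair.
by case: b; case: (flip s); case: (dirs s); case: (dirs (mt s)).
Qed.

Lemma src_dart_of d : dart_src (dart_of d) = corner_of (qsrc nx d).
Proof.
case: d => s b; rewrite /dart_src /dart_of /qsrc /=; case: b => /=.
  by rewrite negbK.
by rewrite /corner_of dirs_nx /nx; case: (dirs s); rewrite ?prev_sideK.
Qed.

Lemma label_dart_of d : dart_label phi (dart_of d) = qlab lab d.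
Proof.
by case: d => s b; rewrite /dart_label /dart_of /qlab /lab /=; case: b; case: (dirs s);
   rewrite ?inv_letterK.
Qed.

Lemma oriented_qvert s t : qvert nx mt fl s t -> same_vertex (corner_of s) (corner_of t).
Proof.
case/connectP=> p; elim: p s => [|a p IHp] s /=; first by move=> _ ->; apply: same_vertex_refl.
case/andP=> /existsP[d /andP[/eqP-> /eqP Ea]] ap tE.
apply: same_vertex_trans (IHp _ ap tE); apply: connect1.
by apply/existsP; exists (dart_of d); rewrite Ea -dart_of_mate !src_dart_of !eqxx.
Qed.

Lemma oriented_immersed d d' : qvert nx mt fl (qsrc nx d) (qsrc nx d') ->
  qlab lab d = qlab lab d' -> d' = d \/ d' = qmate mt fl d.
Proof.
move=> /oriented_qvert; rewrite -!src_dart_of -!label_dart_of => v E.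
have [E'|E'] := imm v E; [left|right]; apply: (inv_inj dart_ofK) => //.
by rewrite dart_of_mate.
Qed.

Lemma oriented_lab_mate s : lab (mt s) = if fl s then inv_letter (lab s) else lab s.
Proof.
have := label_dart_of (qmate mt fl (s, true)).
rewrite dart_of_mate graph_map label_dart_of /qlab /qmate /=.
by case: (fl s) => /= ->; rewrite ?inv_letterK.
Qed.

Lemma size_boundary i : size (boundary_word phi i) = nside i.
Proof. by rewrite /boundary_word /poly_boundary 2!size_map size_enum_ord. Qed.

Lemma nth_boundary (s : side S) : nth l0 (boundary_word phi (tag s)) (tagged s) = phi s.
Proof.
case: s => i j /=; rewrite /boundary_word /poly_boundary -map_comp.
by rewrite (nth_map j) ?size_enum_ord // nth_ord_enum.
Qed.

Lemma posn_side s :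
  [/\ (x s < size u)%N, nth l0 u (x s) = lab s & x (nx s) = ((x s).+1 %% size u)%N].
Proof.
have lt_s : (tagged s < size (boundary_word phi (tag s)))%N by rewrite size_boundary.
have [lt_x nth_x next_x] := posnP lt_s; split=> //.
  by rewrite nth_x /lab /dirs nth_boundary.
rewrite -next_x size_boundary /x /nx /dirs.
by case: s {lt_s lt_x nth_x next_x} => i j /=; case: (dir i).
Qed.

Lemma oriented_lab_take s : take (x s).+1 u = rcons (take (x s) u) (lab s).
Proof. by have [lt_x <- _] := posn_side s; apply: take_nth. Qed.

(** Such a side would follow its own flipped mate along a face, so [u] would contain cyclically
    adjacent inverse letters. *)
Lemma oriented_no_spur s : cyclically_reduced u -> fl s -> nx (mt s) != s.
Proof.
move=> cr fs; apply/eqP => E.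
have [lt_m nth_m next_m] := posn_side (mt s); have [_ nth_s _] := posn_side s.
have := cycle_nth l0 cr lt_m; rewrite -next_m E nth_s nth_m.
by rewrite oriented_lab_mate fs inv_letterK eqxx.
Qed.

(** If every side were degenerate, gluing would pair the corners by a fixed-point-free involution.
    Vertices and edges would then be equally many, leaving the number of faces as Euler
    characteristic. *)
Lemma exists_nondegenerate : (euler_char S < (Defs.npoly S)%:Z)%R ->
  exists s, ~~ fl s -> mt (nx s) != nx (mt s).
Proof.
move=> chi; apply: contrapT => none.
have deg s : fl s = false /\ mt (nx s) = nx (mt s).
  have [fs|nfs] := boolP (fl s); first by case: none; exists s; rewrite fs.
  by split=> //; apply: contrapT => ne; case: none; exists s => _; apply/eqP.
pose f (c : corner S) : corner S := corner_of (mt (side_of c)).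
have fK : involutive f by move=> c; rewrite /f corner_ofK /mt mateK side_ofK.
have f_neq c : f c != c.
  rewrite /f -[X in _ != X]side_ofK (can_eq corner_ofK); exact: mate_neq.
have glueE : corner_glue (S := S) =2 frel f.
  move=> a b; apply/existsP/eqP => [[e /andP[/eqP-> /eqP->]]|<-].
    rewrite -[e]dart_ofK; move: (dart_of e) => d; rewrite -dart_of_mate !src_dart_of /f corner_ofK.
    case: d => s c; have [fs mE] := deg s.
    by rewrite /qsrc /qmate /= fs addbF; case: c; rewrite ?mE.
  exists (dart_of (side_of a, true)); rewrite -dart_of_mate !src_dart_of /qsrc /qmate /=.
  by have [-> _] := deg (side_of a); rewrite side_ofK !eqxx.
have nv : (nvertices S * 2 = #|side S|)%N.
  suff -> : nvertices S = fcard f [pred c : corner S | true] by apply: fcard_involution.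
  by rewrite /nvertices (eq_n_comp (eq_connect glueE)).
have ne : (nedges S * 2 = #|side S|)%N.
  by apply: fcard_involution; [apply: mateK|apply: mate_neq].
move: chi; rewrite /euler_char; move: nv ne; lia.
Qed.

Lemma contains_surface_group_polygonal (w : free_group n) (psi : free_group n -> free_group n) :
  cyclically_reduced u -> (euler_char S < (Defs.npoly S)%:Z)%R ->
  {morph psi : g h / g * h} -> injective psi ->
  (forall g, cyclic_subgroup w (psi g) <-> cyclic_subgroup (free_class u) g) ->
  contains_surface_group (double_group w).
Proof.
move=> cr /exists_nondegenerate[s0 nondeg] psiM psi_inj psi_u.
apply: (contains_surface_group_component oriented_next_inj (@mateK S) (@mate_neq S)
  oriented_flip_mate (u := u) (x := x) (lab := lab) _ _ oriented_lab_take oriented_lab_mate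
  oriented_immersed _ nondeg psiM psi_inj psi_u) => s.
- by have [] := posn_side s.
- by have [] := posn_side s.
- exact: oriented_no_spur.
Qed.

End PolygonalSurface.

Theorem corollary2p14 (n : nat) (n_gt1 : (1 < n)%N) (w : free_group n) :
  equivalent_to_polygonal w -> contains_surface_group (double_group w).
Proof.
case=> f [u [[f' fK f'K] [u_red [S [phi [[graph_map imm bdry] chi]]]] fw]].
(* A default letter for [nth]. *)
have l0 : letter 'I_n := (Ordinal (ltnW n_gt1), true).
have read i : exists dp : bool * (nat -> nat), forall j, (j < size (boundary_word phi i))%N ->
  let b := boundary_word phi i in
  [/\ (dp.2 j < size u)%N,
      nth l0 u (dp.2 j) = if dp.1 then nth l0 b j else inv_letter (nth l0 b j) &
      dp.2 (if dp.1 then j.+1 %% size b else (j + size b).-1 %% size b)%N =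
        ((dp.2 j).+1 %% size u)%N].
  have [_ /(reads_power_position l0)] := bdry i.
  by case=> [|d [p dpP]]; [rewrite size_boundary nside_gt0|exists (d, p)].
have [dp dpP] := choice read.
have fM : {morph f : g h / g * h} := @gmulfM _ _ f.
have f'M : {morph f' : g h / g * h} := can2_gmulfM fK f'K.
(* The labels of the surface spell elements relative to [u]; the inverse automorphism [f'] carries
   them to the factors of the double of [w], taking powers of [u] to powers of [w]. *)
apply: (contains_surface_group_polygonal graph_map imm (dir := fst \o dp) (posn := snd \o dp)
  (l0 := l0) dpP u_red chi f'M (can_inj f'K)) => g.
have f'X k : f' (free_class u ^+ k) = w ^+ k by rewrite -fw -(morph_mulX fM) fK.
have f'XV k : f' (free_class u ^- k) = w ^- k by rewrite (morph_mulV f'M) f'X.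
split=> -[k E]; exists k.
  by case: E => E; [left|right]; apply: (can_inj f'K); rewrite E ?f'X ?f'XV.
by case: E => ->; [left|right].
Qed.
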